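(* Let $d\ge3$. There is a constant $C_2>0$ depending only on $d$ such that for every isotropic unimodal Lévy process $X=(X_t)$ in $\mathbb{R}^d$ with characteristic exponent $\psi\not\equiv0$ and potential measure $G$, $$\frac{C_2}{\psi^*(r^{-1})}\le G(B_r)\le\frac{36e}{\psi^*(r^{-1})},\qquad r>0.$$
   Context: The characteristic exponent is defined by $E^0e^{i\langle\xi,X_t\rangle}=e^{-t\psi(\xi)}$. A measure $m$ on $\mathbb{R}^d$ is isotropic unimodal if there is a non-increasing $m_0:(0,\infty)\to[0,\infty)$ with $m(dx)=m_0(|x|)dx$ on $\mathbb{R}^d\setminus\{0\}$ (an atom at $0$ is allowed); $X$ is isotropic unimodal if $P^0(X_t\in dx)$ is isotropic unimodal for every $t>0$ (then $\psi$ is real and radial). $\psi^*(u)=\sup_{|x|\le u}\psi(x)$. $B_r=B(0,r)$ is the open ball. For $d\ge3$ the process is transient and its potential measure is $G(A)=E^0\int_0^\infty\mathbf 1_A(X_t)dt$. *)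

(* Defs.v *)
From HB Require Import structures.
From mathcomp Require Import all_boot all_order all_algebra.
From mathcomp Require Import complex.
From mathcomp Require Import all_classical all_reals all_analysis.

Set Implicit Arguments.
Unset Strict Implicit.
Unset Printing Implicit Defensive.

Import Order.TTheory GRing.Theory Num.Theory.
Import numFieldNormedType.Exports.

Local Open Scope classical_set_scope.
Local Open Scope ring_scope.

(* Tuples carry the product sigma-algebra, i.e. the Borel sets of R^d. *)
Notation euclid R d := (d.-tuple R).

Section euclidean_space.
Variables (R : realType) (d : nat).

Definition evzero : euclid R d := [tuple 0 | i < d].
Definition evsub (x y : euclid R d) : euclid R d :=
  [tuple tnth x i - tnth y i | i < d].
Definition dotp (x y : euclid R d) : R := \sum_(i < d) tnth x i * tnth y i.
Definition enorm (x : euclid R d) : R := Num.sqrt (dotp x x).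
Definition eball (r : R) : set (euclid R d) := [set x | enorm x < r].

End euclidean_space.
Arguments evzero {R d}.

Section lebesgue_euclid.
Variable R : realType.

Section add_coordinate.
Variables (n : nat) (mu : {sigma_finite_measure set (euclid R n) -> \bar R}).

Definition econs (p : measurableTypeR R * euclid R n) : euclid R n.+1 := [tuple of p.1 :: p.2].

Lemma measurable_econs : measurable_fun [set: measurableTypeR R * euclid R n] econs.
Proof. by apply: measurable_cons; [exact: measurable_fst|exact: measurable_snd]. Qed.

Definition cons_measure : set (euclid R n.+1) -> \bar R :=
  pushforward ((@lebesgue_measure R) \x mu)%E econs.

Let cons_measure0 : cons_measure set0 = 0%E.
Proof. by apply: measure0; exact: measurable_econs. Qed.

Let cons_measure_ge0 A : (0 <= cons_measure A)%E.
Proof. by apply: measure_ge0; exact: measurable_econs. Qed.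

Let cons_measure_sigma_additive : semi_sigma_additive cons_measure.
Proof.
by apply: measure_semi_sigma_additive; exact: measurable_econs.
Qed.

HB.instance Definition _ := isMeasure.Build _ _ _ cons_measure
  cons_measure0 cons_measure_ge0 cons_measure_sigma_additive.

Lemma cons_measure_sigma_finite : sigma_finite setT cons_measure.
Proof.
have /sigma_finiteP[F [TF ndF Foo]] := sigma_finiteT (@lebesgue_measure R).
have /sigma_finiteP[G [TG ndG Goo]] := sigma_finiteT mu.
pose g (x : euclid R n.+1) : measurableTypeR R * euclid R n :=
  (thead x, [tuple of behead x]).
have gK : cancel econs g by move=> [x y]; congr pair; apply/val_inj.
have mg : measurable_fun setT g.
  by apply/measurable_fun_pair; [exact: measurable_tnth|exact: measurable_behead].
exists (fun k => g @^-1` (F k `*` G k)).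
  apply/esym; rewrite -subTset => x _.
  have [i _ Fi] : (\bigcup_i F i) (thead x) by rewrite -TF.
  have [j _ Gj] : (\bigcup_i G i) [tuple of behead x] by rewrite -TG.
  exists (maxn i j) => //; split => /=.
  - by move: Fi; apply/subsetPset/ndF/leq_maxl.
  - by move: Gj; apply/subsetPset/ndG/leq_maxr.
move=> k; have [mF Fk] := Foo k; have [mG Gk] := Goo k; split.
  by rewrite -[X in measurable X]setTI; apply: mg => //; exact: measurableX.
rewrite /cons_measure /pushforward -comp_preimage.
rewrite (_ : g \o econs = id); last by apply/funext => p /=; rewrite gK.
by rewrite preimage_id product_measure1E// lte_mul_pinfty// ge0_fin_numE.
Qed.

HB.instance Definition _ :=
  Measure_isSigmaFinite.Build _ _ _ cons_measure cons_measure_sigma_finite.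

End add_coordinate.

Fixpoint lebesgue_euclid (n : nat) :
    {sigma_finite_measure set (euclid R n) -> \bar R} :=
  match n with
  | 0 => [the {sigma_finite_measure set (euclid R 0) -> \bar R} of
           \d_ ([tuple] : euclid R 0)]
  | n'.+1 => [the {sigma_finite_measure set (euclid R n'.+1) -> \bar R} of
           cons_measure (lebesgue_euclid n')]
  end.

End lebesgue_euclid.

(* Only sets avoiding the origin are constrained, so an atom at 0 is allowed, and
   only the values of [m0] on ]0, +oo[ matter. *)
Definition isotropic_unimodal_measure (R : realType) (d : nat)
    (m : set (euclid R d) -> \bar R) : Prop :=
  exists m0 : R -> R,
    [/\ forall s : R, 0 < s -> 0 <= m0 s,
        forall s t : R, 0 < s -> s <= t -> m0 t <= m0 s &
        forall A : set (euclid R d), measurable A -> ~ A evzero ->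
          m A = (\int[lebesgue_euclid R d]_(x in A) (m0 (enorm x))%:E)%E].

Section levy_process.
Variables (R : realType) (d : nat) (disp : measure_display).
Variables (Omega : measurableType disp) (P : probability Omega R).

(* A process indexed by [0, +oo[; its values at negative times are irrelevant. *)
Variable X : R -> {RV P >-> euclid R d}.

Definition increment (s t : R) (w : Omega) : euclid R d :=
  evsub (X t w) (X s w).

(* Joint independence of X(t_1) - X(t_0), ..., X(t_n) - X(t_{n-1}). The product
   rule for subfamilies is the case where some of the [A i] are [setT]. *)
Definition independent_increments : Prop :=
  forall (n : nat) (t : nat -> R) (A : nat -> set (euclid R d)),
    0 <= t 0%N ->
    (forall i, (i < n)%N -> t i <= t i.+1) ->
    (forall i, (i < n)%N -> measurable (A i)) ->
    P (\bigcap_(i < n) (increment (t i) (t i.+1) @^-1` A i)) =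
    (\prod_(i < n) P (increment (t i) (t i.+1) @^-1` A i))%E.

Definition stationary_increments : Prop :=
  forall (s t : R) (A : set (euclid R d)), 0 <= s -> 0 <= t -> measurable A ->
    P (increment s (s + t) @^-1` A) = P (increment 0 t @^-1` A).

Definition stochastically_continuous : Prop :=
  forall t eps : R, 0 <= t -> 0 < eps ->
    P [set w | eps < enorm (increment t s w)]
      @[s --> within [set s | 0 <= s] (nbhs t)] --> 0%E.

Definition cadlag (f : R -> euclid R d) : Prop :=
  forall i : 'I_d,
    (forall t : R, 0 <= t -> tnth (f s) i @[s --> t^'+] --> tnth (f t) i) /\
    (forall t : R, 0 < t -> cvg (tnth (f s) i @[s --> t^'-])).

Definition levy_process : Prop :=
  [/\ {ae P, forall w, X 0 w = evzero},
      independent_increments,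
      stationary_increments,
      stochastically_continuous &
      {ae P, forall w, cadlag (fun t => X t w)}].

Definition isotropic_unimodal_process : Prop :=
  forall t : R, 0 < t -> isotropic_unimodal_measure (distribution P (X t)).

Definition cexpR (z : R[i]) : R[i] :=
  ((expR (complex.Re z) * cos (complex.Im z)) +i*
   (expR (complex.Re z) * sin (complex.Im z)))%C.

(* E e^{i <xi, Y>}, by real and imaginary parts *)
Definition char_fun (Y : {RV P >-> euclid R d}) (xi : euclid R d) : R[i] :=
  ((\int[P]_w cos (dotp xi (Y w))) +i* (\int[P]_w sin (dotp xi (Y w))))%C.

(* E e^{i <xi, X_t>} = e^{- t psi(xi)}. This for all [t] determines [psi]
   uniquely: differentiate in [t] at 0. *)
Definition char_exponent (psi : euclid R d -> R[i]) : Prop :=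
  forall (t : R) (xi : euclid R d), 0 <= t ->
    char_fun (X t) xi = cexpR (- (t%:C%C * psi xi)).

Definition potential_measure (A : set (euclid R d)) : \bar R :=
  (\int[P]_w \int[@lebesgue_measure R]_(t in `[0%R, +oo[) (\1_A (X t w))%:E)%E.

End levy_process.

(* A characteristic exponent is complex valued in general; it is real for an
   isotropic unimodal process, and then [Re] changes nothing. *)
Definition sup_exponent (R : realType) (d : nat)
    (psi : euclid R d -> R[i]) (u : R) : R :=
  sup [set complex.Re (psi x) | x in [set x : euclid R d | enorm x <= u]].

(* Main.v *)
Require Import Defs.
From mathcomp Require Import all_boot all_order all_algebra.
From mathcomp Require Import complex.
From mathcomp Require Import all_classical all_reals all_analysis.
From mathcomp Require Import measurable_realfun.
From mathcomp Require Import ring lra.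

(** Tonelli's theorem turns the potential of the ball [B_r] into the integral over
    time of the probabilities that [X_t] lies in [B_r]
    ([potential_measure_time_integral]). Write [u = 1 / r]. What has to be seen is
    that the process leaves [B_r] after a time of order [1 / psi^*(u)].

    Lower bound. If [X_t] is outside [B_r], one of its coordinates is at least
    [r / d] in absolute value. This is detected by the mean of one minus the cosine
    of that coordinate over frequencies of order [d / r], whose expectation is at
    most a multiple of [t * psi^*(u)] ([large_coordinate_probability]). Up to a
    time [T] of order [1 / psi^*(u)] the process is therefore in [B_r] with
    probability at least one half, and the potential is at least [T / 2].

    Upper bound. The exponent of an isotropic unimodal process has two properties.
    - It grows at most quadratically: [psi(n xi) <= n^2 psi(xi)]
      ([re_exponentMn]).
    - It is almost monotone: [psi(eta) <= 3 psi(xi)] if [|eta| <= |xi|]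
      ([re_exponent_comparison]). By rotation invariance this is a statement about
      one coordinate. Along lines parallel to an axis, the density is even and
      decreasing away from the origin, hence a mixture of uniform densities on
      symmetric intervals. For the latter the claim is that [1 - sin x / x] is at
      most [3 (1 - sin y / y)] for [x <= y] ([sinc_comparison]).
    Together they give [psi(xi) >= psi^*(u) / (6 (1 + u^2 / |xi|^2))] for all
    nonzero [xi].

    Now average the product of the cosines of [xi_i x_i], [i = 1, 2, 3], over
    [xi] whose three components have independent triangular laws on
    [[0, 5 u / 2]]. The result is a product of Fejer kernels: it is nonnegative, and
    at least [1 / e] on [B_r]. The expectation of the product of cosines of
    [xi_i X_t^i] is at most the exponential of minus [t] times the lower bound for
    [psi(xi)] ([hitting_probability_le]). Integrating over [t] bounds the
    potential of [B_r] by [6 e / psi^*(u)] times the mean of [1 + u^2 / |xi|^2],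
    which is finite since there are three frequencies. The inequality
    [|xi|^2 >= 3 |xi_1 xi_2 xi_3|^(2/3)] makes the second term a product over the
    three components, of mean [4 / 75 * (9 / 2)^3 = 4.86], and
    [6 * 5.86 <= 36] ([potential_upper]). Restricting to three coordinates, whatever
    the dimension, keeps the constant independent of [d]. *)

Set Implicit Arguments.
Unset Strict Implicit.
Unset Printing Implicit Defensive.

Import Order.TTheory GRing.Theory Num.Theory.
Import numFieldNormedType.Exports.

Local Open Scope classical_set_scope.
Local Open Scope ring_scope.

(** * Lebesgue measure on tuples *)

Section vector_operations.
Variables (R : realType) (d : nat).
Implicit Types x y : euclid R d.

Definition evadd x y : euclid R d := [tuple tnth x i + tnth y i | i < d].
Definition evscale (a : R) x : euclid R d := [tuple a * tnth x i | i < d].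

Lemma evaddC x y : evadd x y = evadd y x.
Proof. by apply: eq_from_tnth => i; rewrite !tnth_mktuple addrC. Qed.

Lemma dotpC x y : dotp x y = dotp y x.
Proof. by apply: eq_bigr => i _; rewrite mulrC. Qed.

Lemma dotpDl x y z : dotp (evadd x y) z = dotp x z + dotp y z.
Proof.
by rewrite /dotp -big_split; apply: eq_bigr => i _; rewrite tnth_mktuple mulrDl.
Qed.

Lemma dotpZl a x z : dotp (evscale a x) z = a * dotp x z.
Proof.
by rewrite /dotp mulr_sumr; apply: eq_bigr => i _; rewrite tnth_mktuple mulrA.
Qed.

Lemma dotpZr a x z : dotp z (evscale a x) = a * dotp z x.
Proof. by rewrite dotpC dotpZl dotpC. Qed.

Lemma dotpDr x y z : dotp z (evadd x y) = dotp z x + dotp z y.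
Proof. by rewrite dotpC dotpDl !(dotpC z). Qed.

Lemma dotpp_ge0 x : 0 <= dotp x x.
Proof. by apply: sumr_ge0 => i _; rewrite -expr2 sqr_ge0. Qed.

Lemma dotpp_eq0 x : dotp x x = 0 -> x = evzero.
Proof.
move=> /eqP; rewrite psumr_eq0 => [/allP x0|i _]; last by rewrite -expr2 sqr_ge0.
apply: eq_from_tnth => i; rewrite tnth_mktuple.
by have /implyP/(_ isT) := x0 i (mem_index_enum i); rewrite mulf_eq0 orbb => /eqP.
Qed.

Lemma enorm_ge0 x : 0 <= enorm x. Proof. exact: sqrtr_ge0. Qed.

Lemma enorm_sqr x : enorm x ^+ 2 = dotp x x.
Proof. by rewrite sqr_sqrtr ?dotpp_ge0. Qed.

Lemma enorm0 : enorm (@evzero R d) = 0.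
Proof.
rewrite /enorm /dotp big1 ?sqrtr0// => i _.
by rewrite tnth_mktuple mul0r.
Qed.

Lemma enorm_eq0 x : enorm x = 0 -> x = evzero.
Proof.
by move=> x0; apply: dotpp_eq0; rewrite -enorm_sqr x0 expr0n.
Qed.

Lemma enorm_gt0 x : x <> evzero -> 0 < enorm x.
Proof.
by move=> x0; rewrite lt_neqAle enorm_ge0 andbT; apply/eqP => /esym/enorm_eq0.
Qed.

Lemma enormZ a x : enorm (evscale a x) = `|a| * enorm x.
Proof.
by rewrite /enorm dotpZl dotpZr mulrA -expr2 sqrtrM ?sqr_ge0// sqrtr_sqr.
Qed.

End vector_operations.

Section vector_measurability.
Context (R : realType) (d : nat) (disp : measure_display) (T : measurableType disp).
Implicit Types f g : T -> euclid R d.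

Lemma measurable_coord f i :
  measurable_fun setT f -> measurable_fun setT (fun t => tnth (f t) i).
Proof.
move=> mf; exact: (measurableT_comp (@measurable_tnth _ (measurableTypeR R) d i) mf).
Qed.

Lemma measurable_dotp f g : measurable_fun setT f -> measurable_fun setT g ->
  measurable_fun setT (fun t => dotp (f t) (g t)).
Proof.
move=> mf mg; rewrite /dotp; apply: measurable_sum => i.
by apply: measurable_funM; exact: measurable_coord.
Qed.

Lemma measurable_enorm f :
  measurable_fun setT f -> measurable_fun setT (fun t => enorm (f t)).
Proof.
move=> mf; apply: (measurableT_comp (f := @Num.sqrt R)).
  by apply: continuous_measurable_fun; exact: sqrt_continuous.
exact: measurable_dotp.
Qed.

Lemma measurable_evadd f g : measurable_fun setT f -> measurable_fun setT g ->
  measurable_fun setT (fun t => evadd (f t) (g t)).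
Proof.
move=> mf mg; apply/measurable_fun_tnthP => i.
rewrite (_ : _ \o _ = fun t => tnth (f t) i + tnth (g t) i).
  by apply: measurable_funD; exact: measurable_coord.
by apply/funext => t /=; rewrite tnth_mktuple.
Qed.

Lemma measurable_evscale (a : T -> R) f : measurable_fun setT a ->
  measurable_fun setT f -> measurable_fun setT (fun t => evscale (a t) (f t)).
Proof.
move=> ma mf; apply/measurable_fun_tnthP => i.
rewrite (_ : _ \o _ = fun t => a t * tnth (f t) i).
  by apply: measurable_funM => //; exact: measurable_coord.
by apply/funext => t /=; rewrite tnth_mktuple.
Qed.

End vector_measurability.

Lemma measurable_cos (R : realType) d (T : measurableType d) (f : T -> R) :
  measurable_fun setT f -> measurable_fun setT (fun x => cos (f x)).
Proof.
apply: (measurableT_comp (f := @cos R)).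
exact: continuous_measurable_fun (@continuous_cos R).
Qed.

Section lebesgue_measure_translation.
Context {R : realType}.
Local Notation mu := (@lebesgue_measure R).

Lemma measurable_addl (a : R) : measurable_fun setT
  (fun x : measurableTypeR R => a + x : measurableTypeR R).
Proof. by apply: measurable_funD => //; exact: measurable_cst. Qed.

(** A measure on the line that agrees with Lebesgue measure on half-open
    intervals is Lebesgue measure. *)
Lemma lebesgue_measure_translation (a : R) (A : set R) : measurable A ->
  pushforward mu (fun x : R => a + x : measurableTypeR R) A = mu A.
Proof.
move=> mA; apply/esym/lebesgue_measure_unique => //=.
  exact: measurable_addl.
move=> _ _ [[u v]] _ <-.
rewrite /pushforward (_ : _ @^-1` _ = `](u - a), (v - a)]%classic).
  rewrite !lebesgue_measure_itv/= !lte_fin ltrBlDr subrK -!EFinD.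
  by rewrite (_ : v - a - (u - a) = v - u)//; ring.
by apply/seteqP; split=> x /=; rewrite !in_itv/= ltrBlDl lerBrDl.
Qed.

Lemma ge0_integral_translation (a : R) (f : R -> \bar R) :
  measurable_fun setT f -> (forall x, (0 <= f x)%E) ->
  (\int[mu]_x f (a + x)%R = \int[mu]_x f x)%E.
Proof.
move=> mf f0; pose phi := fun x : R => a + x : measurableTypeR R.
have mphi : measurable_fun setT phi by exact: measurable_addl.
rewrite -[LHS]/(\int[mu]_(x in phi @^-1` setT) (f \o phi) x)%E.
rewrite -ge0_integral_pushforward//=.
apply: eq_measure_integral => //= A mA _.
exact: lebesgue_measure_translation.
Qed.

End lebesgue_measure_translation.

Section lebesgue_euclid_translation.
Context {R : realType}.
Local Notation mu := (@lebesgue_measure R).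
Local Notation lam n := (lebesgue_euclid R n).

Lemma lebesgue_euclidS n (A : set (euclid R n.+1)) : measurable A ->
  lam n.+1 A = (\int[mu]_x lam n [set y | A (econs (x, y))])%E.
Proof.
move=> mA; rewrite /= /cons_measure /pushforward /product_measure1.
apply: eq_integral => x _; congr (lam n _).
by apply/seteqP; split=> y; rewrite /xsection/= inE.
Qed.

Lemma measurable_slice n (A : set (euclid R n.+1)) (x : R) : measurable A ->
  measurable [set y | A (econs (x, y))].
Proof.
move=> mA; rewrite -[X in measurable X]setTI.
have m : measurable_fun setT (@econs R n \o pair (x : measurableTypeR R)).
  exact: (measurableT_comp (@measurable_econs R n) (pair1_measurable _)).
exact: m.
Qed.

Lemma measurable_lebesgue_slice n (A : set (euclid R n.+1)) : measurable A ->
  measurable_fun setT (fun x : measurableTypeR R => lam n [set y | A (econs (x, y))]).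
Proof.
move=> mA.
have mA' : measurable (@econs R n @^-1` A).
  by rewrite -[X in measurable X]setTI; exact: measurable_econs.
have := measurable_fun_xsection (lam n) mA'.
congr (measurable_fun _ _); apply/funext => x /=; congr (lam n _).
by apply/seteqP; split=> y; rewrite /xsection/= inE.
Qed.

Lemma measurable_shift n (v : euclid R n) : measurable_fun setT (evadd v).
Proof. by apply: measurable_evadd => //; exact: measurable_cst. Qed.

(** By induction on the dimension: the slices are translated by the induction
    hypothesis, and the integral over the first coordinate by the one-dimensional
    case. *)
Lemma lebesgue_euclid_translation n (v : euclid R n) (A : set (euclid R n)) :
  measurable A -> lam n (evadd v @^-1` A) = lam n A.
Proof.
elim: n v A => [|n IH] v A mA.
  by congr (lam 0 _); apply/seteqP; split=> x /=;
    rewrite (_ : evadd v x = x)//; apply: eq_from_tnth; case.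
have mvA : measurable (evadd v @^-1` A).
  by rewrite -[X in measurable X]setTI; exact: measurable_shift.
rewrite !lebesgue_euclidS//.
rewrite -[RHS](@ge0_integral_translation R (tnth v ord0)); last 2 first.
- exact: measurable_lebesgue_slice.
- by move=> x; exact: measure_ge0.
apply: eq_integral => x _.
have mS := measurable_slice (tnth v ord0 + x) mA.
rewrite -(IH [tuple tnth v (lift ord0 i) | i < n] _ mS).
congr (lam n _); apply/seteqP.
have E y : evadd v (econs (x : measurableTypeR R, y)) =
    econs (tnth v ord0 + x : measurableTypeR R, evadd [tuple tnth v (lift ord0 i) | i < n] y).
  apply: eq_from_tnth => i; rewrite tnth_mktuple.
  by case: (unliftP ord0 i) => [j ->|->]; rewrite ?tnthS ?tnth0 ?tnth_mktuple.
by split=> y /=; rewrite E.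
Qed.

End lebesgue_euclid_translation.

(** * Linear involutions preserve Lebesgue measure *)

Section tonelli_for_sets.
Context d1 d2 (T1 : measurableType d1) (T2 : measurableType d2) (R : realType).
Variables (m1 : {sigma_finite_measure set T1 -> \bar R})
          (m2 : {sigma_finite_measure set T2 -> \bar R}).

Lemma tonelli_set (S : set (T1 * T2)) : measurable S ->
  (\int[m1]_x m2 [set y | S (x, y)] = \int[m2]_y m1 [set x | S (x, y)])%E.
Proof.
move=> mS; rewrite (eq_integral (fun x => m2 (xsection S x))); last first.
  by move=> x _; congr (m2 _); apply/seteqP; split=> y; rewrite /xsection/= inE.
rewrite [RHS](eq_integral (fun y => m1 (ysection S y))); last first.
  by move=> y _; congr (m1 _); apply/seteqP; split=> x; rewrite /ysection/= inE.
have mS1 : measurable_fun setT (fun z : T1 * T2 => (\1_S z)%:E : \bar R).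
  exact/measurable_EFinP/measurable_indic.
have S0 z : (0 <= (\1_S z)%:E :> \bar R)%E by rewrite lee_fin.
transitivity (\int[m1]_x \int[m2]_y (\1_S (x, y))%:E)%E.
  apply: eq_integral => x _; rewrite -[in LHS](setIT (xsection S x)) -integral_indic//.
    by apply: eq_integral => y _; rewrite !indicE mem_xsection.
  exact: measurable_xsection.
rewrite (fubini_tonelli (fun z => (\1_S z)%:E))//.
apply: eq_integral => y _; rewrite -[in RHS](setIT (ysection S y)) -integral_indic//.
  by apply: eq_integral => x _; rewrite !indicE mem_ysection.
exact: measurable_ysection.
Qed.

End tonelli_for_sets.

Section additive_involutions.
Context {R : realType} {n : nat}.
Local Notation E := (euclid R n).
Local Notation lam := (lebesgue_euclid R n).
Implicit Types (x y : E) (A B : set E) (H : E -> E).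

Definition evopp x : E := evscale (-1) x.

Definition additive_involution H :=
  [/\ measurable_fun setT H, forall x y, H (evadd x y) = evadd (H x) (H y)
    & involutive H].

Lemma additive_involution_evopp : additive_involution evopp.
Proof.
split.
- by apply: measurable_evscale => //; exact: measurable_cst.
- by move=> x y; apply: eq_from_tnth => i; rewrite !tnth_mktuple mulrDr.
- by move=> x; apply: eq_from_tnth => i; rewrite !tnth_mktuple mulrA mulrNN !mul1r.
Qed.

Lemma evaddN x y : evadd (evadd x y) (evopp y) = x.
Proof. by apply: eq_from_tnth => i; rewrite !tnth_mktuple mulN1r addrK. Qed.

Lemma evoppD x y : evopp (evadd x y) = evadd (evopp x) (evopp y).
Proof. by have [_ -> _] := additive_involution_evopp. Qed.

Lemma evoppK : involutive evopp.
Proof. by have [] := additive_involution_evopp. Qed.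

Lemma additive_involutionN H : additive_involution H ->
  forall x, H (evopp x) = evopp (H x).
Proof.
move=> [_ HD _] x.
have e0 : evadd evzero evzero = evzero :> E.
  by apply: eq_from_tnth => i; rewrite !tnth_mktuple addr0.
have He i : tnth (H evzero) i = 0.
  have /(congr1 (fun z => tnth z i)) := HD evzero evzero.
  by rewrite e0 tnth_mktuple => h; lra.
have Nx : evadd (evopp x) x = evzero.
  by apply: eq_from_tnth => i; rewrite !tnth_mktuple mulN1r addNr.
apply: eq_from_tnth => i; have /(congr1 (fun z => tnth z i)) := HD (evopp x) x.
rewrite Nx He !tnth_mktuple mulN1r => /esym/eqP.
by rewrite addr_eq0 => /eqP.
Qed.

(** A change of variables without determinants. Translating [y] by [H x] shows
    that the double integral of [1_A(x) * 1_B(x + H y)] is the left side.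
    Translating [x] by [- H y] instead turns the integrand into
    [1_B(x) * 1_A(x - H y)], whose double integral is, in the same way, the right
    side. *)
Lemma lebesgue_involution_cross H A B : additive_involution H ->
  measurable A -> measurable B ->
  (lam A * lam (H @^-1` B) = lam B * lam (H @^-1` (evopp @^-1` A)))%E.
Proof.
move=> Hi mA mB; have HN := additive_involutionN Hi; have [mH HD HK] := Hi.
have [mN _ _] := additive_involution_evopp.
have pre (f : E -> E) C : measurable_fun setT f -> measurable C -> measurable (f @^-1` C).
  by move=> mf mC; rewrite -[X in measurable X]setTI; exact: mf.
have pre2 (f : E * E -> E) C : measurable_fun setT f -> measurable C -> measurable (f @^-1` C).
  by move=> mf mC; rewrite -[X in measurable X]setTI; exact: mf.
have mHsnd : measurable_fun setT (H \o @snd E E) by exact: measurableT_comp.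
have mS : measurable ((@fst E E) @^-1` A `&` (fun z => evadd z.1 (H z.2)) @^-1` B).
  apply: measurableI; apply: pre2 => //.
  by apply: measurable_evadd => //; exact: mHsnd.
have mT : measurable ((@fst E E) @^-1` B `&`
    (fun z => evadd z.1 (evopp (H z.2))) @^-1` A).
  apply: measurableI; apply: pre2 => //.
  apply: measurable_evadd => //.
  exact: (measurableT_comp mN mHsnd).
have lhs : (\int[lam]_x lam [set y | A x /\ B (evadd x (H y))] = lam A * lam (H @^-1` B))%E.
  rewrite muleC -[in RHS](setIT A) -integral_indic// -ge0_integralZl//;
    last exact/measurable_EFinP/measurable_indic.
  apply: eq_integral => x _; rewrite indicE; case: (boolP (x \in A)) => xA.
    rewrite mule1 -[RHS](lebesgue_euclid_translation (H x)); last exact: pre.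
    congr (lam _); apply/seteqP; split=> y /=; rewrite HD HK.
      by case.
    by split => //; exact: set_mem.
  rewrite mule0 (_ : [set _ | _] = set0) ?measure0//.
  by apply/seteqP; split=> y //= [Ax]; rewrite (mem_set Ax) in xA.
have rhs : (\int[lam]_x lam [set y | B x /\ A (evadd x (evopp (H y)))] =
    lam B * lam (H @^-1` (evopp @^-1` A)))%E.
  rewrite muleC -[in RHS](setIT B) -integral_indic// -ge0_integralZl//;
    last exact/measurable_EFinP/measurable_indic.
  apply: eq_integral => x _; rewrite indicE; case: (boolP (x \in B)) => xB.
    rewrite mule1 -[RHS](lebesgue_euclid_translation (evopp (H x))); last first.
      exact: (pre _ _ mH (pre _ _ mN mA)).
    congr (lam _); apply/seteqP; split=> y /=; rewrite HD HN HK evoppD evoppK.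
      by case.
    by split => //; exact: set_mem.
  rewrite mule0 (_ : [set _ | _] = set0) ?measure0//.
  by apply/seteqP; split=> y //= [Bx]; rewrite (mem_set Bx) in xB.
rewrite -lhs -rhs (tonelli_set lam lam mS) (tonelli_set lam lam mT).
apply: eq_integral => y _; rewrite -[RHS](lebesgue_euclid_translation (H y)); last first.
  have : measurable_fun setT (fun x : E => (x, y)) by exact: pair2_measurable.
  by move=> mp; rewrite -[X in measurable X]setTI; exact: mp.
congr (lam _); apply/seteqP; split=> x /=; rewrite [evadd (H y) x]evaddC evaddN; by case.
Qed.

End additive_involutions.

Section lebesgue_nontrivial.
Context {R : realType}.

Lemma lebesgue_euclid_setT_neq0 n : lebesgue_euclid R n setT != 0%E.
Proof.
elim: n => [|n IH]; first by rewrite /= diracT oner_neq0.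
rewrite lebesgue_euclidS//= (eq_integral (fun=> lebesgue_euclid R n setT)); last first.
  by move=> x _; congr (lebesgue_euclid R n _); apply/seteqP; split.
rewrite integral_cst// mule_neq0//.
rewrite -[X in X != _]/(lebesgue_measure [set: R]).
by have := @lebesgue_measure_itv R `]-oo, +oo[; rewrite set_itvNyy => ->.
Qed.

(** A reference set by whose measure equations can be cancelled. *)
Lemma lebesgue_euclid_finite_positive n : exists F : set (euclid R n),
  [/\ measurable F, (0 < lebesgue_euclid R n F)%E & (lebesgue_euclid R n F < +oo)%E].
Proof.
have /sigma_finiteP[F [TF ndF Foo]] := sigma_finiteT (lebesgue_euclid R n).
apply: contrapT => h.
have F0 k : lebesgue_euclid R n (F k) = 0%E.
  apply: contrapT => /eqP k0; apply: h; exists (F k); have [mF Fk] := Foo k.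
  by split => //; rewrite lt0e k0 measure_ge0.
have := lebesgue_euclid_setT_neq0 n; rewrite TF => /eqP; apply.
apply/eqP; rewrite eq_le measure_ge0 andbT.
apply: (le_trans (measure_sigma_subadditive _ _ _ (@subset_refl _ _))) => //.
- by move=> k; have [] := Foo k.
- by apply: bigcup_measurable => k _; have [] := Foo k.
- by rewrite eseries0// => k _ _; exact: F0.
Qed.

Lemma mule_cancell (x y z : \bar R) : x \is a fin_num -> (0 < x)%E ->
  (x * y = x * z)%E -> y = z.
Proof.
move=> xfin x0 xyz; apply/eqP; rewrite eq_le; apply/andP.
by split; rewrite -(lee_pmul2l xfin x0) xyz.
Qed.

(** The relation between two sets given by [lebesgue_involution_cross] yields,
    for [H := evopp], that the reflection through the origin preserves the measure.
    For general [H] it then says that [H] multiplies the measure of every set by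
    the same constant; as [H] is its own inverse, the square of that constant is
    one. *)
Lemma lebesgue_euclid_involution n (H : euclid R n -> euclid R n) A :
  additive_involution H -> measurable A ->
  lebesgue_euclid R n (H @^-1` A) = lebesgue_euclid R n A.
Proof.
have [F [mF F0 Foo]] := lebesgue_euclid_finite_positive n.
have Ffin : lebesgue_euclid R n F \is a fin_num by rewrite ge0_fin_numE.
have pre (f : euclid R n -> euclid R n) C : measurable_fun setT f ->
    measurable C -> measurable (f @^-1` C).
  by move=> mf mC; rewrite -[X in measurable X]setTI; exact: mf.
have No B : measurable B -> lebesgue_euclid R n (evopp @^-1` B) = lebesgue_euclid R n B.
  move=> mB.
  have := lebesgue_involution_cross additive_involution_evopp mF mB.
  rewrite -comp_preimage (_ : evopp \o evopp = id); last first.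
    by apply/funext => x /=; exact: evoppK.
  rewrite preimage_id [in RHS]muleC.
  exact: mule_cancell.
move=> Hi mA; have [mH HD HK] := Hi.
have cross B C : measurable B -> measurable C ->
    (lebesgue_euclid R n B * lebesgue_euclid R n (H @^-1` C) =
     lebesgue_euclid R n C * lebesgue_euclid R n (H @^-1` B))%E.
  move=> mB mC; rewrite (lebesgue_involution_cross Hi)//; congr *%E.
  rewrite -[RHS]No; last exact: pre.
  congr (lebesgue_euclid R n _); apply/seteqP; split=> x /=;
    by rewrite (additive_involutionN Hi).
have HF : lebesgue_euclid R n (H @^-1` F) = lebesgue_euclid R n F.
  have := cross _ _ mF (pre _ _ mH mF).
  rewrite -comp_preimage (_ : H \o H = id); last by apply/funext => x /=; exact: HK.
  rewrite preimage_id -(fineK Ffin).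
  case E : (lebesgue_euclid R n (H @^-1` F)) => [a| |].
  - rewrite -!EFinM => -[] /eqP; rewrite -!expr2 eqrXn2 ?fine_ge0//; first by move=> /eqP->.
    by rewrite -lee_fin -E.
  - by rewrite mulyy -EFinM.
  - have : (0 <= lebesgue_euclid R n (H @^-1` F))%E by exact: measure_ge0.
    by rewrite E.
have := cross _ _ mF mA; rewrite HF [in RHS]muleC.
by move=> /(mule_cancell Ffin F0) ->.
Qed.

End lebesgue_nontrivial.

Section householder.
Context {R : realType} {n : nat}.
Local Notation E := (euclid R n).
Implicit Types v x y : E.

(** The Householder reflection in the hyperplane orthogonal to [v]; since
    dividing by zero gives zero, it is the identity for [v = evzero]. *)
Definition reflection v x : E :=
  evadd x (evscale (- (2 * dotp v x / dotp v v)) v).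

Lemma additive_involution_reflection v : additive_involution (reflection v).
Proof.
split.
- apply: measurable_evadd => //; apply: measurable_evscale; last exact: measurable_cst.
  apply: measurableT_comp => //; apply: measurable_funM; last exact: measurable_cst.
  apply: measurable_funM; first exact: measurable_cst.
  by apply: measurable_dotp => //; exact: measurable_cst.
- move=> x y; apply: eq_from_tnth => i; rewrite /reflection !tnth_mktuple.
  by rewrite dotpDr; ring.
- move=> x; apply: eq_from_tnth => i; rewrite /reflection !tnth_mktuple.
  rewrite dotpDr dotpZr.
  have [v0|v0] := eqVneq (dotp v v) 0; first by rewrite v0 invr0 !mulr0 oppr0 !mul0r !addr0.
  by field.
Qed.

Lemma reflection_isometry v x y : dotp (reflection v x) (reflection v y) = dotp x y.
Proof.
rewrite /reflection !dotpDl !dotpDr !dotpZl !dotpZr (dotpC x v).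
have [v0|v0] := eqVneq (dotp v v) 0; first by rewrite v0 invr0 !mulr0 !oppr0 !mul0r !addr0.
by field.
Qed.

Lemma reflection_adjoint v x y : dotp (reflection v x) y = dotp x (reflection v y).
Proof.
have [_ _ vK] := additive_involution_reflection v.
by rewrite -[in LHS](vK y) reflection_isometry.
Qed.

Lemma enorm_reflection v x : enorm (reflection v x) = enorm x.
Proof. by rewrite /enorm reflection_isometry. Qed.

(** Vectors of equal length are exchanged by the reflection in their bisecting
    hyperplane. *)
Lemma reflection_swap x y : enorm x = enorm y ->
  reflection (evsub x y) x = y.
Proof.
move=> xy.
have [->|nxy] := pselect (x = y).
  apply: eq_from_tnth => i; rewrite /reflection !tnth_mktuple.
  by rewrite subrr mulr0 addr0.
have xxyy : dotp x x = dotp y y by rewrite -!enorm_sqr xy.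
have subE : evsub x y = evadd x (evscale (-1) y).
  by apply: eq_from_tnth => i; rewrite !tnth_mktuple mulN1r.
have vv : dotp (evsub x y) (evsub x y) = 2 * dotp (evsub x y) x.
  by rewrite subE !dotpDl !dotpDr !dotpZl !dotpZr (dotpC y x) -xxyy; ring.
have v0 : dotp (evsub x y) (evsub x y) != 0.
  apply/eqP => /dotpp_eq0 e; apply: nxy; apply: eq_from_tnth => i.
  have := congr1 (fun z => tnth z i) e; rewrite /evsub /evzero !tnth_mktuple.
  by move/eqP; rewrite subr_eq0 => /eqP.
rewrite /reflection -vv divff//; apply: eq_from_tnth => i.
by rewrite !tnth_mktuple mulN1r opprB addrC subrK.
Qed.

End householder.

(** * Layer-cake integration and invariance of isotropic laws *)

Section layer_cake.
Context d (T : measurableType d) (R : realType).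
Variable mu : {sigma_finite_measure set T -> \bar R}.
Local Notation leb := (@lebesgue_measure R).

Lemma measurable_layers (F : T -> R) : measurable_fun setT F ->
  measurable [set z : T * measurableTypeR R | 0 <= z.2 < F z.1].
Proof.
move=> mF.
have mF1 : measurable_fun setT (fun z : T * measurableTypeR R => F z.1).
  exact: (measurableT_comp mF).
have m1 : measurable_fun setT (fun z : T * measurableTypeR R => 0 <= z.2).
  by apply: measurable_fun_ler => //; exact: measurable_snd.
have m2 : measurable_fun setT (fun z : T * measurableTypeR R => z.2 < F z.1).
  by apply: measurable_fun_ltr => //; exact: measurable_snd.
have := measurableI _ _ (m1 measurableT [set true] I) (m2 measurableT [set true] I).
congr measurable; apply/seteqP; split => z /=.
  by move=> [[_ ->] [_ ->]].
by move=> /andP[-> ->].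
Qed.

(** Tonelli's theorem, as [F x] is the length of the set of [s] such that
    [0 <= s < F x]. *)
Lemma weighted_layer_cake (g F : T -> R) :
  measurable_fun setT g -> measurable_fun setT F ->
  (forall x, 0 <= g x) -> (forall x, 0 <= F x) ->
  (\int[mu]_x (g x * F x)%:E =
   \int[leb]_s \int[mu]_x (g x * \1_[set x | (0 <= s < F x)%R] x)%:E)%E.
Proof.
move=> mg mF g0 F0; have mS := measurable_layers mF.
set S := [set z | _] in mS.
pose f (z : T * measurableTypeR R) : \bar R := (g z.1 * \1_S z)%:E.
have mf : measurable_fun setT f.
  apply/measurable_EFinP; apply: measurable_funM; last exact: measurable_indic.
  exact: (measurableT_comp mg).
have f0 z : (0 <= f z)%E by rewrite lee_fin mulr_ge0.
transitivity (\int[leb]_s \int[mu]_x f (x, s))%E; last first.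
  apply: eq_integral => s _; apply: eq_integral => x _; rewrite /f.
  by congr (_ * _)%:E; rewrite !indicE; congr ((_ : bool)%:R); apply/idP/idP; rewrite !inE.
rewrite -(fubini_tonelli f)//; apply: eq_integral => x _; rewrite /f/=.
under eq_integral do rewrite EFinM.
rewrite ge0_integralZl//; last 2 first.
- have mi : measurable_fun setT (\1_S : T * measurableTypeR R -> R) by exact: measurable_indic.
  by apply/measurable_EFinP; exact: (measurableT_comp mi (pair1_measurable x)).
- by rewrite lee_fin.
rewrite EFinM; congr *%E; apply/esym.
transitivity (\int[leb]_s (\1_`[0%R, F x[ s)%:E)%E.
  apply: eq_integral => s _; rewrite !indicE; congr (_%:R%:E); congr nat_of_bool.
transitivity (leb `[0%R, F x[); first by rewrite integral_indic// setIT.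
rewrite lebesgue_measure_itv/= lte_fin.
by case: ltP (F0 x) => [_ _|Fx Fx']; rewrite ?oppr0 ?adde0 ?subr0//; congr (_%:E); apply/le_anti/andP.
Qed.

End layer_cake.

Section isotropic_laws.
Context {R : realType} {n : nat}.
Local Notation E := (euclid R n).
Local Notation lam := (lebesgue_euclid R n).

(** [isotropic_unimodal_measure] with a profile that is measurable and
    nonnegative on the whole line. *)
Definition radial_density (m : set E -> \bar R) (rho : R -> R) : Prop :=
  [/\ measurable_fun setT rho, forall s, 0 <= rho s,
      forall s t, 0 < s -> s <= t -> rho t <= rho s &
      forall A, measurable A -> ~ A evzero ->
        m A = (\int[lam]_(x in A) (rho (enorm x))%:E)%E].

(** A nonincreasing profile is measurable because its superlevel sets are
    intervals; outside [`]0, +oo[], where nothing is known, it is replaced by zero. *)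
Lemma isotropic_radial_density (m : set E -> \bar R) :
  isotropic_unimodal_measure m -> exists rho, radial_density m rho.
Proof.
move=> [m0 [m0_ge0 m0_ni mE]].
exists (m0 \_ `]0, +oo[); split.
- apply/(measurable_restrictT _ _).1; first exact: measurable_itv.
  apply: (measurability (@RGenCInfty.G R)).
    exact: RGenCInfty.measurableE.
  move=> /= _ [_] [r] -> <-.
  apply: is_interval_measurable => s t/=.
  rewrite !in_itv/= !andbT => -[s0 ms] [t0 mt] u /andP[su ut].
  have u0 : 0 < u by exact: lt_le_trans su.
  split; rewrite /= in_itv/= andbT//.
  by rewrite (le_trans mt)// m0_ni.
- by move=> s; rewrite patchE; case: ifPn => //; rewrite inE/= in_itv/= andbT; exact: m0_ge0.
- move=> s t s0 st; have t0 := lt_le_trans s0 st.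
  by rewrite !patchE !mem_set/= ?in_itv/= ?s0 ?t0//; exact: m0_ni.
- move=> A mA A0; rewrite mE//; apply: eq_integral => x /[!inE] Ax.
  rewrite patchE mem_set//= in_itv/= andbT; apply: enorm_gt0 => x0.
  by apply: A0; rewrite -x0.
Qed.

(** Since the law may have an atom at the origin, its density represents
    only the integrals of functions vanishing there; those are reached from
    indicator functions of sets avoiding the origin by the layer-cake formula. *)
Lemma integral_radial_density (m : probability E R) rho (F : E -> R) :
  radial_density m rho -> measurable_fun setT F -> (forall x, 0 <= F x) ->
  F evzero = 0 ->
  (\int[m]_x (F x)%:E = \int[lam]_x (F x * rho (enorm x))%:E)%E.
Proof.
move=> [mrho rho0 rho_ni mE] mF F0 F00.
have mr : measurable_fun setT (fun x : E => rho (enorm x)).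
  by apply: (measurableT_comp mrho); exact: measurable_enorm.
transitivity (\int[m]_x (1 * F x)%:E)%E; first by under [RHS]eq_integral do rewrite mul1r.
rewrite weighted_layer_cake//.
under [RHS]eq_integral do rewrite mulrC.
rewrite weighted_layer_cake//; apply: eq_integral => s _.
have mA : measurable [set x | 0 <= s < F x].
  have mS := measurable_layers mF.
  have mp : measurable_fun setT (fun x : E => (x, s : measurableTypeR R)).
    exact: pair2_measurable.
  by rewrite -[X in measurable X]setTI; exact: (mp measurableT _ mS).
under eq_integral do rewrite mul1r.
have A0 : ~ [set x | 0 <= s < F x] evzero.
  by rewrite /= F00 => /andP[s0]; rewrite ltNge s0.
transitivity (m [set x | 0 <= s < F x]); first by rewrite integral_indic// setIT.
rewrite (mE _ mA A0).
rewrite integral_mkcond; apply: eq_integral => x _.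
rewrite patchE indicE; case: ifPn => _; by rewrite ?mulr1 ?mulr0.
Qed.

(** For sets avoiding the origin, the radial density and Lebesgue measure are
    both invariant. The other sets are complements of such sets, and the total
    mass is one. *)
Lemma isotropic_law_invariant (m : probability E R) (H : E -> E) A :
  isotropic_unimodal_measure m -> additive_involution H ->
  (forall x, enorm (H x) = enorm x) -> measurable A -> m (H @^-1` A) = m A.
Proof.
move=> /isotropic_radial_density[rho [mrho rho0 _ mE]] Hi Hn mA.
have [mH _ _] := Hi.
have H0 : H evzero = evzero by apply: enorm_eq0; rewrite Hn enorm0.
have mr : measurable_fun setT (fun x : E => (rho (enorm x))%:E).
  by apply/measurable_EFinP; apply: (measurableT_comp mrho); exact: measurable_enorm.
have pre C : measurable C -> measurable (H @^-1` C).
  by move=> mC; rewrite -[X in measurable X]setTI; exact: mH.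
have avoid B : measurable B -> ~ B evzero -> m (H @^-1` B) = m B.
  move=> mB B0; rewrite mE//; [|exact: pre|by rewrite /= H0].
  pose g := (fun x : E => (rho (enorm x))%:E).
  transitivity (\int[lam]_(x in H @^-1` B) (g \o H) x)%E.
    by apply: eq_integral => x _; rewrite /g/= Hn.
  rewrite -ge0_integral_pushforward//; last 2 first.
  - exact: measurable_funTS.
  - by move=> x _; rewrite lee_fin.
  rewrite (mE _ mB B0).
  apply: eq_measure_integral => // C mC _.
  exact: lebesgue_euclid_involution.
have [A0|A0] := pselect (A evzero); last exact: avoid.
have mCA := measurableC mA.
have := avoid _ mCA; rewrite preimage_setC !probability_setC//; last exact: pre.
move=> /(_ (fun h => h A0)).
have fA : m A \is a fin_num by exact: fin_num_measure.
have fHA : m (H @^-1` A) \is a fin_num by apply: fin_num_measure; exact: pre.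
rewrite -(fineK fA) -(fineK fHA) -!EFinB => -[] /(congr1 (fun r => 1 - r)).
by rewrite !subKr => ->.
Qed.

End isotropic_laws.

Section isotropic_random_vectors.
Context {R : realType} {n : nat} {disp : measure_display}.
Context {Omega : measurableType disp} (P : probability Omega R).
Local Notation E := (euclid R n).
Variable Y : {RV P >-> E}.
Hypothesis Yiso : isotropic_unimodal_measure (distribution P Y).

Lemma bounded_measurable_integrable (f : Omega -> R) (M : R) :
  measurable_fun setT f -> (forall x, `|f x| <= M) ->
  P.-integrable setT (EFin \o f).
Proof.
move=> mf fM; apply: measurable_bounded_integrable => //.
  by rewrite (le_lt_trans (probability_le1 _ _))// ltry.
by exists M; split; [exact: num_real|move=> N MN x _; exact: le_trans (ltW MN)].
Qed.

Lemma isotropic_Rintegral (f : E -> R) (M : R) (H : E -> E) :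
  measurable_fun setT f -> (forall x, `|f x| <= M) ->
  additive_involution H -> (forall x, enorm (H x) = enorm x) ->
  \int[P]_w f (H (Y w)) = \int[P]_w f (Y w).
Proof.
move=> mf fM Hi Hn; have [mH _ _] := Hi.
have mY : measurable_fun setT Y by [].
have mHY : measurable_fun setT (H \o Y) by exact: measurableT_comp.
pose Z : {RV P >-> E} := mfun_Sub (mem_set mHY).
congr fine.
transitivity (\int[distribution P Z]_x (f x)%:E)%E.
  rewrite integral_distribution//; first exact/measurable_EFinP.
  by apply: (@bounded_measurable_integrable _ M) => //; apply: measurableT_comp.
transitivity (\int[distribution P Y]_x (f x)%:E)%E; last first.
  rewrite integral_distribution//; first exact/measurable_EFinP.
  by apply: (@bounded_measurable_integrable _ M) => //; apply: measurableT_comp.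
apply: eq_measure_integral => A mA _.
exact: (isotropic_law_invariant Yiso Hi Hn mA).
Qed.

(** The law is invariant under the reflection that exchanges the two
    frequencies. *)
Lemma isotropic_cos_radial (xi eta : E) : enorm xi = enorm eta ->
  \int[P]_w cos (dotp xi (Y w)) = \int[P]_w cos (dotp eta (Y w)).
Proof.
move=> xe.
rewrite -(@isotropic_Rintegral (fun x => cos (dotp xi x)) 1 (reflection (evsub xi eta))).
- by apply: eq_Rintegral => w _; rewrite -reflection_adjoint reflection_swap.
- apply: measurableT_comp; first exact: continuous_measurable_fun (@continuous_cos R).
  by apply: measurable_dotp => //; exact: measurable_cst.
- by move=> x; exact: cos_max.
- exact: additive_involution_reflection.
- exact: enorm_reflection.
Qed.

(** The law is symmetric about the origin, whereas the sine is odd. *)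
Lemma isotropic_sin_eq0 (xi : E) : \int[P]_w sin (dotp xi (Y w)) = 0.
Proof.
have ms : measurable_fun setT (fun x : E => sin (dotp xi x)).
  apply: measurableT_comp; first exact: continuous_measurable_fun (@continuous_sin R).
  by apply: measurable_dotp => //; exact: measurable_cst.
have := @isotropic_Rintegral (fun x => sin (dotp xi x)) 1 evopp ms
  (fun x => sin_max _) additive_involution_evopp.
have -> : \int[P]_w sin (dotp xi (evopp (Y w))) = - \int[P]_w sin (dotp xi (Y w)).
  rewrite -mulN1r -RintegralZl//; last first.
    apply: (@bounded_measurable_integrable _ 1) => [|x]; last exact: sin_max.
    have mY : measurable_fun setT Y by [].
    exact: (measurableT_comp ms mY).
  by apply: eq_Rintegral => w _; rewrite /evopp dotpZr !mulN1r sinN.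
have Hn (x : E) : enorm (evopp x) = enorm x :> R by rewrite enormZ normrN1 mul1r.
move=> /(_ Hn) h; lra.
Qed.

End isotropic_random_vectors.

(** * Comparing Fourier transforms of unimodal densities on the line *)

Section trigonometric_bounds.
Context {R : realType}.
Implicit Types x y : R.

Lemma ge0_of_derive_ge0 (f df : R -> R) :
  (forall x, is_derive x 1 f (df x)) -> f 0 = 0 ->
  (forall x, 0 <= x -> 0 <= df x) -> forall x, 0 <= x -> 0 <= f x.
Proof.
move=> fdf f0 df0 x x0.
have [|c /[!in_itv]/= /andP[c0 _] fE] := @MVT_segment R f df 0 x x0 (fun y _ => fdf y).
  apply/continuous_subspaceT => y; apply/differentiable_continuous/derivable1_diffP.
  by have [] := fdf y.
by move: fE; rewrite f0 !subr0 => ->; rewrite mulr_ge0// df0.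
Qed.

Lemma is_derive_monomial (a : R) n x :
  is_derive x 1 (fun y => a * y ^+ n.+1) (a * (n.+1%:R * x ^+ n)).
Proof.
have h : is_derive x 1 (a \*: (@id R ^+ n.+1)) (a *: ((n.+1%:R * x ^+ n) *: 1)).
  exact: is_deriveZ.
move: h; rewrite /GRing.scale/= mulr1.
by congr is_derive; apply/funext => y; rewrite !fctE.
Qed.

Lemma is_derive_sinM (a x : R) : is_derive x 1 (fun y => sin (a * y)) (a * cos (a * x)).
Proof.
have h : is_derive x 1 (fun y : R => a * y) a.
  by have := is_derive_monomial a 0 x; rewrite mulr1 mulr1.
by rewrite [a * cos _]mulrC; exact: is_derive1_comp.
Qed.

Lemma is_derive_cosM (a x : R) : is_derive x 1 (fun y => cos (a * y)) (- (a * sin (a * x))).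
Proof.
have h : is_derive x 1 (fun y : R => a * y) a.
  by have := is_derive_monomial a 0 x; rewrite mulr1 mulr1.
by rewrite [a * sin _]mulrC -mulNr; exact: is_derive1_comp.
Qed.

(** Comparing derivatives turns this bound into the next, and so on up to
    [sin_le_quintic]. *)
Lemma sin_le_id x : 0 <= x -> sin x <= x.
Proof.
move=> x0; rewrite -subr_ge0.
apply: (@ge0_of_derive_ge0 (fun x => x - sin x) (fun x => 1 - cos x)) x0.
- by rewrite sin0 subrr.
- by move=> y _; rewrite subr_ge0 cos_le1.
Qed.

Lemma cos_ge_quadratic x : 1 - x ^+ 2 / 2 <= cos x.
Proof.
wlog x0 : x / 0 <= x.
  move=> h; have [|x0] := leP 0 x; first exact: h.
  by have := h (- x); rewrite cosN sqrrN; apply; rewrite oppr_ge0 ltW.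
have -> : (1 - x ^+ 2 / 2 <= cos x) = (0 <= (cos x + 2^-1 * x ^+ 2) - 1).
  by rewrite -subr_ge0; congr (_ <= _); ring.
apply: (@ge0_of_derive_ge0 (fun x => (cos x + 2^-1 * x ^+ 2) - 1)
  (fun x => (- sin x + 2^-1 * (2%:R * x ^+ 1)) - 0)) x0.
- move=> y; apply: is_deriveB; apply: is_deriveD; exact: is_derive_monomial.
- by rewrite cos0 expr0n/= mulr0 addr0 subrr.
- by move=> y y0; have := sin_le_id y0; lra.
Qed.

Lemma sin_ge_cubic x : 0 <= x -> x - x ^+ 3 / 6 <= sin x.
Proof.
have -> : (x - x ^+ 3 / 6 <= sin x) = (0 <= (sin x + 6^-1 * x ^+ 3) - x).
  by rewrite -subr_ge0; congr (_ <= _); ring.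
apply: (@ge0_of_derive_ge0 (fun x => (sin x + 6^-1 * x ^+ 3) - x)
  (fun x => (cos x + 6^-1 * (3%:R * x ^+ 2)) - 1)).
- move=> y; apply: is_deriveB; apply: is_deriveD; exact: is_derive_monomial.
- by rewrite sin0 expr0n/= mulr0 addr0 subrr.
- by move=> y y0; have := cos_ge_quadratic y; lra.
Qed.

Lemma cos_le_quartic x : 0 <= x -> cos x <= 1 - x ^+ 2 / 2 + x ^+ 4 / 24.
Proof.
have -> : (cos x <= 1 - x ^+ 2 / 2 + x ^+ 4 / 24) =
    (0 <= (1 + - 2^-1 * x ^+ 2 + 24^-1 * x ^+ 4) - cos x).
  by rewrite -subr_ge0; congr (_ <= _); ring.
apply: (@ge0_of_derive_ge0 (fun x => (1 + - 2^-1 * x ^+ 2 + 24^-1 * x ^+ 4) - cos x)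
  (fun x => (0 + - 2^-1 * (2%:R * x ^+ 1) + 24^-1 * (4%:R * x ^+ 3)) - - sin x)).
- move=> y; apply: is_deriveB; apply: is_deriveD; last exact: is_derive_monomial.
  apply: is_deriveD; exact: is_derive_monomial.
- by rewrite cos0 !expr0n/= !mulr0 !addr0 subrr.
- by move=> y y0; have := sin_ge_cubic y0; lra.
Qed.

Lemma sin_le_quintic x : 0 <= x -> sin x <= x - x ^+ 3 / 6 + x ^+ 5 / 120.
Proof.
have -> : (sin x <= x - x ^+ 3 / 6 + x ^+ 5 / 120) =
    (0 <= (x + - 6^-1 * x ^+ 3 + 120^-1 * x ^+ 5) - sin x).
  by rewrite -subr_ge0; congr (_ <= _); ring.
apply: (@ge0_of_derive_ge0 (fun x => (x + - 6^-1 * x ^+ 3 + 120^-1 * x ^+ 5) - sin x)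
  (fun x => (1 + - 6^-1 * (3%:R * x ^+ 2) + 120^-1 * (5%:R * x ^+ 4)) - cos x)).
- move=> y; apply: is_deriveB; apply: is_deriveD; last exact: is_derive_monomial.
  apply: is_deriveD; exact: is_derive_monomial.
- by rewrite sin0 !expr0n/= !mulr0 !addr0 subrr.
- by move=> y y0; have := cos_le_quartic y0; lra.
Qed.

(** For [y <= 2] both sides are compared with their Taylor polynomials, using
    [y ^+ 2 <= 4]. For [y > 2] the right side is at least [3 / 2], while the left
    side is at most [x ^+ 2 / 6 <= 3 / 2] if [x <= 3], and at most
    [1 + 1 / x <= 4 / 3] otherwise. *)
Lemma sinc_comparison x y : 0 < x -> x <= y ->
  1 - sin x / x <= 3 * (1 - sin y / y).
Proof.
move=> x0 xy; have y0 := lt_le_trans x0 xy.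
have up1 : 1 - sin x / x <= x ^+ 2 / 6.
  rewrite lerBlDr -lerBlDl ler_pdivlMr//.
  by have := sin_ge_cubic (ltW x0); rewrite (_ : x - x ^+ 3 / 6 = (1 - x ^+ 2 / 6) * x)//; ring.
have up2 : 1 - sin x / x <= 1 + x^-1.
  by rewrite lerD2l -mulNr ler_pdivrMr// mulVf ?gt_eqF// lerNl sin_geN1.
have [y2|y2] := leP y 2.
  have low : y ^+ 2 / 6 - y ^+ 4 / 120 <= 1 - sin y / y.
    rewrite lerBrDr -lerBrDl ler_pdivrMr//.
    have := sin_le_quintic (ltW y0).
    by rewrite (_ : y - y ^+ 3 / 6 + y ^+ 5 / 120 =
      (1 - (y ^+ 2 / 6 - y ^+ 4 / 120)) * y)//; ring.
  have xy2 : x ^+ 2 <= y ^+ 2 by rewrite lerXn2r// nnegrE ltW.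
  have y22 : y ^+ 2 <= 4.
    by rewrite [leRHS](_ : _ = 2 ^+ 2); [rewrite lerXn2r ?nnegrE// ltW|ring].
  have y4 : y ^+ 4 = y ^+ 2 * y ^+ 2 by rewrite -exprD.
  have := sqr_ge0 y; move: (y ^+ 2) (x ^+ 2) xy2 y22 y4 low up1 => Y X XY Y4 yE low up1 Y0.
  have : 0 <= Y * (4 - Y) by apply: mulr_ge0; lra.
  by rewrite yE in low; nra.
have low : 1 / 2 <= 1 - sin y / y.
  rewrite lerBrDr -lerBrDl ler_pdivrMr//.
  by have := sin_le1 y; lra.
have [x3|x3] := leP x 3.
  have : x ^+ 2 <= 9.
    by rewrite [leRHS](_ : _ = 3 ^+ 2); [rewrite lerXn2r ?nnegrE// ltW|ring].
  lra.
have : x^-1 <= 3^-1 by rewrite lef_pV2 ?posrE ?ltW.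
lra.
Qed.

End trigonometric_bounds.

Section integral_helpers.
Context d (T : measurableType d) (R : realType) (mu : {measure set T -> \bar R}).

Lemma integral_mul_indic (A : set T) (f : T -> R) :
  (\int[mu]_x (f x * \1_A x)%:E = \int[mu]_(x in A) (f x)%:E)%E.
Proof.
rewrite [RHS]integral_mkcond; apply: eq_integral => x _.
by rewrite patchE indicE; case: ifPn => _; rewrite ?mulr1 ?mulr0.
Qed.

Lemma le_integral_ge0 (f g : T -> R) : measurable_fun setT f -> measurable_fun setT g ->
  (forall x, 0 <= f x) -> (forall x, f x <= g x) ->
  (\int[mu]_x (f x)%:E <= \int[mu]_x (g x)%:E)%E.
Proof.
move=> mf mg f0 fg; apply: ge0_le_integral => //.
- by move=> x _; rewrite lee_fin.
- exact/measurable_EFinP.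
- exact/measurable_EFinP.
- by move=> x _; rewrite lee_fin.
Qed.

End integral_helpers.

Section layer_cake_monotonicity.
Context d (T : measurableType d) (R : realType).
Variable mu : {sigma_finite_measure set T -> \bar R}.

(** Integrate the hypothesis over [s] and apply [weighted_layer_cake] twice. *)
Lemma layer_cake_le (g1 g2 F : T -> R) :
  measurable_fun setT g1 -> measurable_fun setT g2 -> measurable_fun setT F ->
  (forall x, 0 <= g1 x) -> (forall x, 0 <= g2 x) -> (forall x, 0 <= F x) ->
  (forall s, 0 <= s ->
    (\int[mu]_x (g1 x * \1_[set x | (0 <= s < F x)%R] x)%:E <=
     \int[mu]_x (g2 x * \1_[set x | (0 <= s < F x)%R] x)%:E)%E) ->
  (\int[mu]_x (g1 x * F x)%:E <= \int[mu]_x (g2 x * F x)%:E)%E.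
Proof.
move=> mg1 mg2 mF g10 g20 F0 H.
have layer_measurable (g : T -> R) : measurable_fun setT g -> (forall x, 0 <= g x) ->
    measurable_fun setT (fun s : measurableTypeR R =>
      (\int[mu]_x (g x * \1_[set x | (0 <= s < F x)%R] x)%:E)%E).
  move=> mg g0; have mS := measurable_layers mF; set S := [set z | _] in mS.
  pose f (z : T * measurableTypeR R) : \bar R := (g z.1 * \1_S z)%:E.
  have mf : measurable_fun setT f.
    apply/measurable_EFinP; apply: measurable_funM; last exact: measurable_indic.
    exact: (measurableT_comp mg).
  have f0 z : (0 <= f z)%E by rewrite lee_fin mulr_ge0.
  exact: (measurable_fun_fubini_tonelli_G (m1 := mu) f mf f0).
rewrite (weighted_layer_cake mu mg1 mF g10 F0) (weighted_layer_cake mu mg2 mF g20 F0).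
apply: ge0_le_integral => //.
- by move=> s _; apply: integral_ge0 => x _; rewrite lee_fin mulr_ge0.
- exact: (layer_measurable g1 mg1 g10).
- exact: (layer_measurable g2 mg2 g20).
- move=> s _.
  have [sge|s0] := pselect (0 <= s); first exact: H.
  rewrite (_ : [set x | _] = set0); last first.
    by apply/seteqP; split => x //= /andP[].
  by under eq_integral do rewrite indic0 mulr0;
     under [leRHS]eq_integral do rewrite indic0 mulr0.
Qed.

End layer_cake_monotonicity.

Section unimodal_comparison.
Context {R : realType}.
Local Notation leb := (@lebesgue_measure R).
Implicit Types (a u v x : R).

Lemma measurable_1Bcos v : measurable_fun setT (fun x : R => 1 - cos (v * x)).
Proof.
apply: measurable_funB; first exact: measurable_cst.
apply: measurable_cos.
by apply: measurable_funM => //; exact: measurable_cst.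
Qed.

Lemma integral_1Bcos v a : 0 < v -> 0 < a ->
  (\int[leb]_(x in `[(- a)%R, a]) (1 - cos (v * x))%:E =
   (2 * a * (1 - sin (v * a) / (v * a)))%:E)%E.
Proof.
move=> v0 a0.
pose F x := x - v^-1 * sin (v * x).
have dF x : is_derive x 1 F (1 - cos (v * x)).
  have h : is_derive x 1 (v^-1 \*: (fun y => sin (v * y))) (v^-1 *: (v * cos (v * x))).
    by apply: is_deriveZ; exact: is_derive_sinM.
  rewrite [X in is_derive _ _ _ (_ - X)](_ : _ = v^-1 *: (v * cos (v * x))); last first.
    by rewrite /GRing.scale/= mulrA mulVf ?mul1r// gt_eqF.
  exact: is_deriveB.
have cont (g : R -> R) (dg : R -> R) : (forall x, is_derive x 1 g (dg x)) -> continuous g.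
  move=> gdg x; apply/differentiable_continuous/derivable1_diffP.
  by have [] := gdg x.
rewrite (@continuous_FTC2 R (fun x => 1 - cos (v * x)) F).
- rewrite -EFinB; congr (_%:E); rewrite /F mulrN sinN.
  by field; rewrite !gt_eqF.
- by rewrite gtrN.
- apply: continuous_subspaceT => x; apply: continuousB; first exact: cst_continuous.
  exact: (cont _ _ (is_derive_cosM v)).
- split => [x _| |].
  + by have [] := dF x.
  + by apply: cvg_at_right_filter; exact: (cont _ _ dF).
  + by apply: cvg_at_left_filter; exact: (cont _ _ dF).
- by move=> x _; rewrite derive1E; have [_ ->] := dF x.
Qed.

(** The two intervals differ at their ends because a symmetric superlevel set
    of half-width [a] lies between the open and the closed interval. *)
Lemma interval_cos_comparison v u a : 0 < v -> v <= u -> 0 < a ->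
  (\int[leb]_(x in `[(- a)%R, a]) (1 - cos (v * x))%:E <=
   \int[leb]_(x in `](- a)%R, a[) (3 * (1 - cos (u * x)))%:E)%E.
Proof.
move=> v0 vu a0; have u0 := lt_le_trans v0 vu.
rewrite integral_1Bcos//.
rewrite -(@integral_itv_bndoo R (- a) a _ true false); last first.
  apply/measurable_EFinP; apply: measurable_funTS; apply: measurable_funM; first exact: measurable_cst.
  exact: measurable_1Bcos.
under eq_integral do rewrite EFinM.
have mc : measurable_fun `[- a, a] (fun x => (1 - cos (u * x))%:E).
  by apply/measurable_EFinP; apply: measurable_funTS; exact: measurable_1Bcos.
have c0 x : `[- a, a]%classic x -> (0 <= (1 - cos (u * x))%:E)%E.
  by move=> _; rewrite lee_fin subr_ge0 cos_le1.
rewrite (ge0_integralZl leb _ mc c0)//.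
rewrite integral_1Bcos// -EFinM lee_fin.
have := @sinc_comparison R (v * a) (u * a).
rewrite mulr_gt0// ler_pM2r// => /(_ isT vu) h.
by rewrite mulrCA ler_wpM2l// mulr_ge0// ltW.
Qed.

(** Superlevel sets of a unimodal density are, up to the origin, symmetric
    intervals, so the comparison on intervals integrates up to one for densities.
    The truncation to [`[- N, N]] keeps their half-widths finite. *)
Lemma unimodal_cos_comparison (h : R -> R) (N v u : R) :
  measurable_fun setT h -> (forall x, 0 <= h x) ->
  (forall x y, 0 < `|x| -> `|x| <= `|y| -> h y <= h x) ->
  0 < v -> v <= u ->
  (\int[leb]_x ((1 - cos (v * x)) * \1_`[(- N)%R, N] x * h x)%:E <=
   \int[leb]_x (3 * (1 - cos (u * x)) * \1_`[(- N)%R, N] x * h x)%:E)%E.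
Proof.
move=> mh h0 h_uni v0 vu.
have c0 w x : 0 <= 1 - cos (w * x) by rewrite subr_ge0 cos_le1.
have mI : measurable_fun setT (\1_`[(- N)%R, N] : R -> R) by exact: measurable_indic.
have m3 : measurable_fun setT (fun x => 3 * (1 - cos (u * x))).
  by apply: measurable_funM; [exact: measurable_cst|exact: measurable_1Bcos].
apply: (layer_cake_le (mu := leb)) => //.
- by apply: measurable_funM => //; exact: measurable_1Bcos.
- exact: measurable_funM.
move=> s s0.
have mS : measurable [set x | 0 <= s < h x].
  have m := measurable_fun_ltr (f := cst s) (measurable_cst _) mh.
  rewrite (_ : [set x | _] = setT `&` (fun x => s < h x) @^-1` [set true]).
    exact: m.
  by apply/seteqP; split => x /=; rewrite s0/=; [move=> ->|case].
set S := [set x | _] in mS *.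
have mIS : measurable_fun setT (\1_S : R -> R) by exact: measurable_indic.
(* The half-width of the truncated superlevel set [S] is the supremum of [K]. *)
pose K := [set `|x| | x in [set x | [/\ S x, - N <= x <= N & x != 0]]].
have [[k Kk]|K0] := pselect (K !=set0); last first.
  rewrite integral0_eq; last first.
    move=> x _; rewrite !indicE.
    have [->|x0] := eqVneq x 0; first by rewrite mulr0 cos0 subrr !mul0r.
    case: (boolP (x \in S)) => xS; last by rewrite mulr0.
    case: (boolP (x \in _)) => xN; last by rewrite mulr0 mul0r.
    exfalso; apply: K0; exists `|x|, x => //; split=> //; first exact: set_mem.
    by move/set_mem: xN; rewrite /= in_itv.
  by apply: integral_ge0 => x _; rewrite lee_fin; do ?[apply: mulr_ge0 => //].
have supK : has_sup K.
  split; first by exists k.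
  exists N => _ [x [_ xN _] <-]; by rewrite ler_norml.
set a := sup K.
have a0 : 0 < a.
  have [x [_ _ x0] xk] := Kk.
  apply: (@lt_le_trans _ _ k); first by rewrite -xk normr_gt0.
  exact: sup_upper_bound.
apply: (@le_trans _ _ (\int[leb]_(x in `[(- a)%R, a]) (1 - cos (v * x))%:E)%E).
  rewrite -[leRHS]integral_mul_indic; apply: le_integral_ge0.
  - apply: measurable_funM => //; apply: measurable_funM => //; exact: measurable_1Bcos.
  - by apply: measurable_funM; [exact: measurable_1Bcos|exact: measurable_indic].
  - by move=> x; do ?[apply: mulr_ge0 => //].
  - move=> x; have [->|x0] := eqVneq x 0; first by rewrite mulr0 cos0 subrr !mul0r.
    rewrite -mulrA ler_wpM2l// !indicE.
    case: (boolP (x \in S)) => xS; last by rewrite mulr0.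
    case: (boolP (x \in `[(- N)%R, N]%classic)) => xN; last by rewrite mul0r.
    rewrite mulr1 mem_set//= in_itv/= -ler_norml.
    apply: sup_upper_bound => //; exists x => //; split=> //; first exact: set_mem.
    by move/set_mem: xN; rewrite /= in_itv.
apply: (le_trans (interval_cos_comparison v0 vu a0)).
rewrite -[leLHS]integral_mul_indic; apply: le_integral_ge0.
- by apply: measurable_funM => //; exact: measurable_indic.
- by apply: measurable_funM => //; apply: measurable_funM.
- by move=> x; do ?[apply: mulr_ge0 => //].
- move=> x; have [->|x0] := eqVneq x 0; first by rewrite mulr0 cos0 subrr mulr0 !mul0r.
  rewrite -[leRHS]mulrA ler_wpM2l ?mulr_ge0// !indicE.
  case: (boolP (x \in `](- a)%R, a[%classic)) => xa; last by rewrite mulr_ge0.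
  have := set_mem xa.
  rewrite /= in_itv/= -ltr_norml => /(sup_gt supK.1)[_ [y [Sy yN y0] <-] xy].
  rewrite !mem_set ?mulr1//.
    rewrite /S/= s0/=; move: Sy => /andP[_ sy]; apply: (lt_le_trans sy).
    by apply: h_uni; [rewrite normr_gt0|exact: ltW].
  rewrite /= in_itv/= -ler_norml (le_trans (ltW xy))//.
  by rewrite ler_norml.
Qed.

End unimodal_comparison.

Section comparison_of_coordinates.
Context {R : realType}.
Local Notation leb := (@lebesgue_measure R).

Lemma integral_lebesgue_euclidS k (F : euclid R k.+1 -> R) :
  measurable_fun setT F -> (forall x, 0 <= F x) ->
  (\int[lebesgue_euclid R k.+1]_x (F x)%:E =
   \int[lebesgue_euclid R k]_y \int[leb]_x (F (econs (x, y)))%:E)%E.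
Proof.
move=> mF F0.
have mFe : measurable_fun setT (fun z => (F (@econs R k z))%:E).
  apply/measurable_EFinP; exact: (measurableT_comp mF (@measurable_econs R k)).
rewrite -(fubini_tonelli2 (m1 := leb) (m2 := lebesgue_euclid R k)
  (fun z => (F (econs z))%:E))//.
transitivity (\int[leb \x lebesgue_euclid R k]_(z in @econs R k @^-1` setT)
  ((fun x => (F x)%:E) \o @econs R k) z)%E; last by [].
rewrite -ge0_integral_pushforward//.
- exact: measurable_econs.
- exact/measurable_EFinP.
- by move=> x _; rewrite lee_fin.
- by move=> x; rewrite lee_fin.
Qed.

Lemma measurable_truncated_1Bcos (a w N : R) :
  measurable_fun setT (fun x : R => a * (1 - cos (w * x)) * \1_`[(- N)%R, N] x).
Proof.
apply: measurable_funM; last exact: measurable_indic.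
by apply: measurable_funM; [exact: measurable_cst|exact: measurable_1Bcos].
Qed.

(** Along every line parallel to the first axis, the density of the law is
    unimodal, so the one-dimensional comparison applies for fixed values of the
    other coordinates. *)
Lemma isotropic_truncated_comparison k (m : probability (euclid R k.+1) R) (N v u : R) :
  isotropic_unimodal_measure m -> 0 < v -> v <= u ->
  (\int[m]_x (1 * (1 - cos (v * tnth x ord0)) * \1_`[(- N)%R, N] (tnth x ord0))%:E <=
   \int[m]_x (3 * (1 - cos (u * tnth x ord0)) * \1_`[(- N)%R, N] (tnth x ord0))%:E)%E.
Proof.
move=> /isotropic_radial_density[rho mrho] v0 vu.
have [mr r0 r_ni _] := mrho.
pose G (a w : R) (x : euclid R k.+1) : R :=
  a * (1 - cos (w * tnth x ord0)) * \1_`[(- N)%R, N] (tnth x ord0).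
have mc : measurable_fun setT (fun x : euclid R k.+1 => tnth x ord0 : measurableTypeR R).
  exact: measurable_tnth.
have mG a w : measurable_fun setT (G a w).
  exact: (measurableT_comp (measurable_truncated_1Bcos a w N) mc).
have G0 a w x : 0 <= a -> 0 <= G a w x.
  by move=> a0; rewrite mulr_ge0// mulr_ge0// subr_ge0 cos_le1.
have Gz a w : G a w evzero = 0.
  by rewrite /G tnth_mktuple mulr0 cos0 subrr mulr0 mul0r.
have mrE : measurable_fun setT (fun x : euclid R k.+1 => rho (enorm x)).
  by apply: (measurableT_comp mr); exact: measurable_enorm.
rewrite -[leLHS]/(\int[m]_x (G 1 v x)%:E)%E -[leRHS]/(\int[m]_x (G 3 u x)%:E)%E.
have G1 x : 0 <= G 1 v x by exact: G0.
have G3 x : 0 <= G 3 u x by exact: G0.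
rewrite (integral_radial_density mrho (mG 1 v) G1 (Gz 1 v)).
rewrite (integral_radial_density mrho (mG 3 u) G3 (Gz 3 u)).
have mGr a w : measurable_fun setT (fun x => G a w x * rho (enorm x)).
  exact: measurable_funM.
have [Gr1 Gr3] : (forall x, 0 <= G 1 v x * rho (enorm x)) /\
  (forall x, 0 <= G 3 u x * rho (enorm x)) by split=> x; exact: mulr_ge0.
rewrite (integral_lebesgue_euclidS (mGr 1 v) Gr1) (integral_lebesgue_euclidS (mGr 3 u) Gr3).
have mslice a w : (forall x, 0 <= G a w x * rho (enorm x)) ->
    measurable_fun setT (fun y => \int[leb]_x
      (G a w (econs (x : measurableTypeR R, y)) * rho (enorm (econs (x : measurableTypeR R, y))))%:E)%E.
  move=> h.
  apply: (measurable_fun_fubini_tonelli_G (m1 := leb)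
    (fun z => (G a w (@econs R k z) * rho (enorm (econs z)))%:E)) => //.
    apply/measurable_EFinP; exact: (measurableT_comp (mGr a w) (@measurable_econs R k)).
  by move=> z; rewrite lee_fin.
apply: ge0_le_integral => //.
- by move=> y _; apply: integral_ge0 => x _; rewrite lee_fin.
- exact: mslice.
- exact: mslice.
move=> y _.
have nE (x : R) : enorm (econs (x : measurableTypeR R, y)) = Num.sqrt (x ^+ 2 + dotp y y).
  rewrite /enorm {1}/dotp big_ord_recl tnth0 -expr2; congr (Num.sqrt (_ + _)).
  by apply: eq_bigr => i _; rewrite !tnthS.
have H := @unimodal_cos_comparison R (fun x => rho (enorm (econs (x : measurableTypeR R, y)))) N v u.
have -> : (\int[leb]_x (G 1 v (econs (x, y)) * rho (enorm (econs (x, y))))%:E =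
    \int[leb]_x ((1 - cos (v * x)) * \1_`[(- N)%R, N] x * rho (enorm (econs (x, y))))%:E)%E.
  by apply: eq_integral => x _; rewrite /G tnth0 mul1r.
have -> : (\int[leb]_x (G 3 u (econs (x, y)) * rho (enorm (econs (x, y))))%:E =
    \int[leb]_x (3 * (1 - cos (u * x)) * \1_`[(- N)%R, N] x * rho (enorm (econs (x, y))))%:E)%E.
  by apply: eq_integral => x _; rewrite /G tnth0.
apply: H => //.
- exact: (measurableT_comp mrE (measurableT_comp (@measurable_econs R k) (pair2_measurable y))).
- move=> x z x0 xz; apply: r_ni; rewrite !nE.
    by rewrite sqrtr_gt0 ltr_wpDr ?dotpp_ge0// exprn_even_gt0//= -normr_gt0.
  rewrite ler_wsqrtr// lerD2r -[leLHS]real_normK ?num_real// -[leRHS]real_normK ?num_real//.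
  by rewrite lerXn2r// nnegrE.
Qed.

Context {disp : measure_display} {Omega : measurableType disp} (P : probability Omega R).

Lemma Rintegral_1Bcos (f : Omega -> R) : measurable_fun setT f ->
  (\int[P]_w (1 - cos (f w))%:E = (1 - \int[P]_w cos (f w))%:E)%E.
Proof.
move=> mf.
have mcf : measurable_fun setT (fun w => cos (f w)).
  exact: measurable_cos.
have icf : P.-integrable setT (EFin \o (fun w => cos (f w))).
  by apply: (@bounded_measurable_integrable _ _ _ _ _ 1) => // x; exact: cos_max.
have i1 : P.-integrable setT (EFin \o (fun w : Omega => 1 : R)).
  by apply: (@bounded_measurable_integrable _ _ _ _ _ 1) => // x; rewrite normr1.
rewrite -[LHS]fineK; last first.
  apply: integrable_fin_num => //.
  apply: (@bounded_measurable_integrable _ _ _ _ _ 2).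
    by apply: measurable_funB.
  by move=> x; rewrite ger0_norm ?subr_ge0 ?cos_le1//; have := cos_geN1 (f x); lra.
congr (_%:E); rewrite -[LHS]/(\int[P]_w (1 - cos (f w))) RintegralB//.
rewrite Rintegral_cst// mul1r; congr (_ - _).
by rewrite -[LHS]/(fine (P setT)) probability_setT.
Qed.

(** Monotone convergence removes the truncation. *)
Lemma isotropic_coordinate_comparison k (Y : {RV P >-> euclid R k.+1}) (v u : R) :
  isotropic_unimodal_measure (distribution P Y) -> 0 < v -> v <= u ->
  1 - \int[P]_w cos (v * tnth (Y w) ord0) <=
  3 * (1 - \int[P]_w cos (u * tnth (Y w) ord0)).
Proof.
move=> Yiso v0 vu.
have mY : measurable_fun setT (fun w => tnth (Y w) ord0 : measurableTypeR R).
  exact: measurable_coord.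
have mYw (c : R) : measurable_fun setT (fun w => c * tnth (Y w) ord0).
  by apply: measurable_funM => //; exact: measurable_cst.
have c0 (c : R) w : 0 <= 1 - cos (c * tnth (Y w) ord0) by rewrite subr_ge0 cos_le1.
have mcw (c : R) : measurable_fun setT (fun w => 1 - cos (c * tnth (Y w) ord0)).
  exact: (measurableT_comp (measurable_1Bcos c) mY).
pose f (N : nat) w := (1 * (1 - cos (v * tnth (Y w) ord0)) *
  \1_`[(- N%:R)%R, N%:R] (tnth (Y w) ord0))%:E.
have mf N : measurable_fun setT (f N).
  apply/measurable_EFinP; exact: (measurableT_comp (measurable_truncated_1Bcos 1 v N%:R) mY).
have f0 N w : (0 <= f N w)%E by rewrite lee_fin mulr_ge0// mul1r.
have bound N : (\int[P]_w f N w <= \int[P]_w (3 * (1 - cos (u * tnth (Y w) ord0)))%:E)%E.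
  have mG a c : measurable_fun setT (fun x : euclid R k.+1 =>
      (a * (1 - cos (c * tnth x ord0)) * \1_`[(- N%:R)%R, N%:R] (tnth x ord0))%:E).
    apply/measurable_EFinP.
    exact: (measurableT_comp (measurable_truncated_1Bcos a c N%:R) (measurable_tnth _)).
  have G0 (a c : R) (x : euclid R k.+1) : 0 <= a -> (0 <=
      (a * (1 - cos (c * tnth x ord0)) * \1_`[(- N%:R)%R, N%:R] (tnth x ord0))%:E)%E.
    by move=> a0; rewrite lee_fin mulr_ge0// mulr_ge0// subr_ge0 cos_le1.
  have := @isotropic_truncated_comparison k (distribution P Y) N%:R v u Yiso v0 vu.
  rewrite (ge0_integral_distribution Y (mG 1 v)); last by move=> x; exact: G0.
  rewrite (ge0_integral_distribution Y (mG 3 u)); last by move=> x; exact: G0.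
  move=> /le_trans; apply.
  apply: le_integral_ge0.
  - exact: (measurableT_comp (measurable_truncated_1Bcos 3 u N%:R) mY).
  - by apply: measurable_funM => //; exact: measurable_cst.
  - by move=> w; rewrite mulr_ge0// mulr_ge0.
  - by move=> w; rewrite ler_piMr ?mulr_ge0// indicE lern1 leq_b1.
have fnd w : nondecreasing_seq (f ^~ w).
  move=> i j ij; rewrite lee_fin ler_wpM2l ?mul1r// !indicE ler_nat.
  case: (boolP (_ \in _)) => // /set_mem/= iw; rewrite mem_set//=.
  move: iw; rewrite !in_itv/= -!ler_norml => /le_trans; apply.
  by rewrite ler_nat.
have flim w : limn (f ^~ w) = (1 - cos (v * tnth (Y w) ord0))%:E.
  apply/cvg_lim => //; apply: cvg_near_cst.
  have [N Nw] : exists N : nat, `|tnth (Y w) ord0| <= N%:R.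
    by exists (Num.truncn `|tnth (Y w) ord0|).+1; rewrite ltW// truncnS_gt.
  exists N => // i /= Ni; rewrite /f indicE mem_set ?mulr1 ?mul1r//= in_itv/= -ler_norml.
  by rewrite (le_trans Nw)// ler_nat.
have : (\int[P]_w (1 - cos (v * tnth (Y w) ord0))%:E <=
        \int[P]_w (3 * (1 - cos (u * tnth (Y w) ord0)))%:E)%E.
  under eq_integral do rewrite -flim.
  rewrite (monotone_convergence P measurableT mf (fun N w _ => f0 N w) (fun w _ => fnd w)).
  apply: lime_le; last exact: nearW.
  apply: ereal_nondecreasing_is_cvgn => i j ij.
  by apply: ge0_le_integral => // w _; exact: fnd.
under [leRHS]eq_integral do rewrite EFinM.
rewrite ge0_integralZl_EFin//; last exact/measurable_EFinP.
by rewrite !Rintegral_1Bcos// -EFinM lee_fin.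
Qed.

End comparison_of_coordinates.

(** * The characteristic exponent of an isotropic unimodal process *)

Section rates.
Context {R : realType}.
Implicit Types a b C x y : R.

Lemma expRN_le1 x : 0 <= x -> 1 - expR (- x) <= x.
Proof. by move=> x0; have := expR_ge1Dx (- x); lra. Qed.

(** Comparing [1 - exp(-t a)] with [1 - exp(-t b)] for all small [t] compares
    the derivatives [a] and [b] at zero. *)
Lemma rate_comparison a b C : 0 <= a -> 0 <= b -> 0 <= C ->
  (forall t, 0 < t -> 1 - expR (- (t * a)) <= C * (1 - expR (- (t * b)))) ->
  a <= C * b.
Proof.
move=> a0 b0 C0 H; rewrite leNgt; apply/negP => Cba.
have D0 : 0 <= C * b * a by rewrite !mulr_ge0.
pose t := (a - C * b) / (C * b * a + 1).
have t0 : 0 < t by rewrite divr_gt0// ?subr_gt0// ltr_wpDl.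
have ta0 : 0 <= t * a by rewrite mulr_ge0// ltW.
have h1 := H t t0.
have h2 : 1 - expR (- (t * b)) <= t * b by rewrite expRN_le1// mulr_ge0// ltW.
have h3 : expR (- (t * a)) * (1 + t * a) <= 1.
  rewrite expRN -ler_pdivlMl ?invr_gt0 ?expR_gt0// invrK mulr1.
  exact: expR_ge1Dx.
have h4 : 1 - expR (- (t * a)) <= C * (t * b).
  by apply: (le_trans h1); rewrite ler_wpM2l.
have h5 : t * a <= C * (t * b) * (1 + t * a).
  have : (1 - expR (- (t * a))) * (1 + t * a) <= C * (t * b) * (1 + t * a).
    by rewrite ler_wpM2r// addr_ge0.
  lra.
have h6 : a <= C * b * (1 + t * a).
  by rewrite -(ler_pM2l t0) (_ : t * (C * b * _) = C * (t * b) * (1 + t * a))//; ring.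
have : t * (C * b * a) < a - C * b.
  by rewrite /t mulrAC ltr_pdivrMr ?ltr_wpDl// ltr_pM2l ?subr_gt0// ltrDl.
have : a <= C * b + t * (C * b * a) by apply: (le_trans h6); rewrite le_eqVlt; apply/orP; left; apply/eqP; ring.
lra.
Qed.

Lemma cos_double y : 1 - cos (y + y) = 2 * sin y ^+ 2.
Proof. by rewrite cosD -!expr2; have := cos2Dsin2 y; lra. Qed.

Lemma norm_sinMn n y : `|sin (n%:R * y)| <= n%:R * `|sin y|.
Proof.
elim: n => [|n IH]; first by rewrite !mul0r sin0 normr0.
rewrite -natr1 !mulrDl !mul1r sinD; apply: (le_trans (ler_normD _ _)).
rewrite !normrM lerD//.
  by apply: le_trans IH; rewrite ler_piMr// cos_max.
by rewrite ler_piMl// cos_max.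
Qed.

(** Half-angle formula and [`|sin (n * y)| <= n * `|sin y|]. *)
Lemma oneBcosMn n y : 1 - cos (n%:R * y) <= n%:R ^+ 2 * (1 - cos y).
Proof.
have [z ->] : exists z, y = z + z by exists (y / 2); rewrite -splitr.
rewrite mulrDr !cos_double [leRHS]mulrCA ler_pM2l// -exprMn.
rewrite -[leLHS]real_normK ?num_real// -[leRHS]real_normK ?num_real//.
by rewrite lerXn2r ?nnegrE// normrM normr_nat norm_sinMn.
Qed.

End rates.

Section exponent.
Context {R : realType} {k : nat} {disp : measure_display}.
Context {Omega : measurableType disp} (P : probability Omega R).
Local Notation E := (euclid R k.+1).
Variables (X : R -> {RV P >-> E}) (psi : E -> R[i]).
Hypothesis Xiso : isotropic_unimodal_process X.
Hypothesis Xchar : char_exponent X psi.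
Local Notation repsi xi := (complex.Re (psi xi)).
Local Notation sup_psi := (sup_exponent psi).

Definition evbasis (i : 'I_k.+1) : E := [tuple (j == i)%:R | j < k.+1].

Lemma dotp_evbasis i x : dotp (evbasis i) x = tnth x i.
Proof.
rewrite /dotp (bigD1 i)//= big1 ?addr0 => [|j /negPf ji]; first by rewrite tnth_mktuple eqxx mul1r.
by rewrite tnth_mktuple ji mul0r.
Qed.

Lemma enorm_evbasis i : enorm (evbasis i) = 1.
Proof. by rewrite /enorm dotp_evbasis tnth_mktuple eqxx sqrtr1. Qed.

Lemma char_fun_parts t xi : 0 <= t ->
  \int[P]_w cos (dotp xi (X t w)) =
    expR (- (t * repsi xi)) * cos (t * complex.Im (psi xi)) /\
  \int[P]_w sin (dotp xi (X t w)) =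
    - (expR (- (t * repsi xi)) * sin (t * complex.Im (psi xi))).
Proof.
move=> t0; have := Xchar xi t0; rewrite /char_fun /cexpR.
case: (psi xi) => a b /=.
by rewrite !mul0r subr0 addr0 cosN sinN mulrN => -[-> ->].
Qed.

(** The imaginary part of the characteristic function is zero at all times,
    among them the time at which [t * Im (psi xi)] would be [pi / 2] up to sign. *)
Lemma char_exponent_real xi : complex.Im (psi xi) = 0.
Proof.
set b := complex.Im _; apply/eqP; apply: contrapT => /negP b0.
have nb0 : 0 < `|b| by rewrite normr_gt0.
have t0 : 0 < pi / 2 / `|b| by rewrite !divr_gt0// pi_gt0.
have [_] := char_fun_parts xi (ltW t0).
rewrite (isotropic_sin_eq0 (Xiso t0)) -/b => /esym/eqP; rewrite oppr_eq0 mulf_eq0 expR_eq0/=.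
have [bp|bn] := ltP 0 b.
  by rewrite gtr0_norm// divfK ?(gt_eqF bp)// sin_pihalf oner_eq0.
have {}bn : b < 0 by rewrite lt_neqAle b0.
by rewrite ltr0_norm// invrN mulrN mulNr divfK ?(lt_eqF bn)// sinN sin_pihalf oppr_eq0 oner_eq0.
Qed.

Lemma cos_expectation t xi : 0 <= t ->
  \int[P]_w cos (dotp xi (X t w)) = expR (- (t * repsi xi)).
Proof.
by move=> t0; have [-> _] := char_fun_parts xi t0; rewrite char_exponent_real mulr0 cos0 mulr1.
Qed.

Lemma measurable_dotX t xi : measurable_fun setT (fun w => dotp xi (X t w)).
Proof. by apply: measurable_dotp => //; exact: measurable_cst. Qed.

Lemma oneB_cos_expectation t xi : 0 <= t ->
  (\int[P]_w (1 - cos (dotp xi (X t w)))%:E = (1 - expR (- (t * repsi xi)))%:E)%E.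
Proof.
move=> t0; rewrite (Rintegral_1Bcos P (measurable_dotX t xi)).
by rewrite cos_expectation.
Qed.

Lemma re_exponent_ge0 xi : 0 <= repsi xi.
Proof.
have : (0 <= (1 - expR (- (1 * repsi xi)))%:E)%E.
  rewrite -(oneB_cos_expectation xi ler01); apply: integral_ge0 => w _.
  by rewrite lee_fin subr_ge0 cos_le1.
by rewrite lee_fin subr_ge0 mul1r -[leRHS]expR0 ler_expR oppr_le0.
Qed.

Lemma re_exponent_radial xi eta : enorm xi = enorm eta -> repsi xi = repsi eta.
Proof.
move=> xe; have := isotropic_cos_radial (Xiso ltr01) xe.
rewrite !cos_expectation// => /expR_inj/eqP.
by rewrite !mul1r eqr_opp => /eqP.
Qed.

Lemma re_exponent0 : repsi evzero = 0.
Proof.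
have := cos_expectation evzero (ler01 : 0 <= 1 :> R).
have z w : cos (dotp evzero (X 1 w)) = 1.
  by rewrite /dotp big1 ?cos0// => i _; rewrite tnth_mktuple mul0r.
under eq_Rintegral do rewrite z.
rewrite Rintegral_cst// mul1r -[X in X = _ -> _]/(fine (P setT)) probability_setT/=.
by rewrite mul1r -expR0 => /expR_inj/esym/eqP; rewrite oppr_eq0 => /eqP.
Qed.

(** By rotation invariance both frequencies may be taken on the first axis,
    where [isotropic_coordinate_comparison] applies at every time; then let the
    time tend to zero. *)
Lemma re_exponent_comparison xi eta : enorm eta <= enorm xi ->
  repsi eta <= 3 * repsi xi.
Proof.
have [->|/eqP eta0] := eqVneq eta evzero.
  by move=> _; rewrite re_exponent0 mulr_ge0// re_exponent_ge0.
move=> ex; have e0 := enorm_gt0 eta0.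
have radE x : 0 < enorm x -> repsi x = repsi (evscale (enorm x) (evbasis ord0)).
  by move=> x0; apply: re_exponent_radial; rewrite enormZ enorm_evbasis mulr1 gtr0_norm.
rewrite (radE eta)// (radE xi); last exact: lt_le_trans ex.
apply: rate_comparison => //; try exact: re_exponent_ge0.
move=> t t0; have := isotropic_coordinate_comparison (Xiso t0) e0 ex.
rewrite -!(cos_expectation _ (ltW t0)).
by congr (1 - _ <= 3 * (1 - _)); apply: eq_Rintegral => w _; rewrite dotpZl dotp_evbasis.
Qed.

(** The expectation of [oneBcosMn] at small times. *)
Lemma re_exponentMn n xi : repsi (evscale n%:R xi) <= n%:R ^+ 2 * repsi xi.
Proof.
apply: rate_comparison; rewrite ?sqr_ge0 ?re_exponent_ge0// => t t0.
have m1 eta : measurable_fun setT (fun w => 1 - cos (dotp eta (X t w))).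
  apply: measurable_funB; first exact: measurable_cst.
  by apply: measurable_cos; exact: measurable_dotX.
rewrite -lee_fin EFinM -!oneB_cos_expectation ?(ltW t0)//.
have c0 w : setT w -> (0 <= (1 - cos (dotp xi (X t w)))%:E)%E.
  by move=> _; rewrite lee_fin subr_ge0 cos_le1.
have mc : measurable_fun setT (fun w => (1 - cos (dotp xi (X t w)))%:E).
  exact/measurable_EFinP.
rewrite -(ge0_integralZl_EFin P measurableT c0 mc) ?sqr_ge0//.
apply: ge0_le_integral => //.
- exact/measurable_EFinP/m1.
- exact: measurable_funeM.
- by move=> w _; rewrite -EFinM lee_fin dotpZl oneBcosMn.
Qed.

Lemma evscaleK (a : R) (x : E) : a != 0 -> evscale a (evscale a^-1 x) = x.
Proof.
by move=> a0; apply: eq_from_tnth => i; rewrite !tnth_mktuple mulrA divff// mul1r.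
Qed.

(** The comparison with a point of the sphere of radius [u] shows that the
    supremum is taken over a bounded set. *)
Lemma re_exponent_le_sup u x : 0 <= u -> enorm x <= u -> repsi x <= sup_psi u.
Proof.
move=> u0 xu; apply: sup_upper_bound; last by exists x.
split; first by exists (repsi x), x.
exists (3 * repsi (evscale u (evbasis ord0))) => _ [y yu <-].
by apply: re_exponent_comparison; rewrite enormZ enorm_evbasis mulr1 ger0_norm.
Qed.

Lemma re_exponent_le_sup_scaled n u x : 0 <= u -> (0 < n)%N ->
  enorm x <= n%:R * u -> repsi x <= n%:R ^+ 2 * sup_psi u.
Proof.
move=> u0 n0 xnu; have n0' : 0 < n%:R :> R by rewrite ltr0n.
rewrite -[x in repsi x](@evscaleK n%:R) ?gt_eqF//.
apply: (le_trans (re_exponentMn _ _)); rewrite ler_wpM2l ?sqr_ge0//.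
apply: re_exponent_le_sup => //.
by rewrite enormZ gtr0_norm ?invr_gt0// mulrC ler_pdivrMr// mulrC.
Qed.

(** The exponent at one point controls it on a whole ball: first scale the
    ball down by the integer [n], then compare with the given point. *)
Lemma sup_exponent_le n u xi : 0 <= u -> (0 < n)%N -> u <= n%:R * enorm xi ->
  sup_psi u <= n%:R ^+ 2 * (3 * repsi xi).
Proof.
move=> u0 n0 unx; have n0' : 0 < n%:R :> R by rewrite ltr0n.
apply: ge_sup.
  by exists (repsi evzero), evzero => //=; rewrite enorm0.
move=> _ [x /= xu <-].
rewrite -[x in repsi x](@evscaleK n%:R) ?gt_eqF//.
apply: (le_trans (re_exponentMn _ _)); rewrite ler_wpM2l ?sqr_ge0//.
apply: re_exponent_comparison.
rewrite enormZ gtr0_norm ?invr_gt0// mulrC ler_pdivrMr// mulrC.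
exact: le_trans unx.
Qed.

(** Scaling down a point where the exponent does not vanish brings it into the
    ball, and by [re_exponentMn] the exponent does not vanish there either. *)
Lemma sup_exponent_gt0 u : 0 < u -> (exists xi, psi xi <> 0) -> 0 < sup_psi u.
Proof.
move=> u0 [xi xi0].
have xip : 0 < repsi xi.
  rewrite lt_neqAle re_exponent_ge0 andbT; apply/eqP => h; apply: xi0.
  by move: h (char_exponent_real xi); case: (psi xi) => a b /= <- ->.
pose n := (Num.truncn (enorm xi / u)).+1.
have : repsi xi <= n%:R ^+ 2 * sup_psi u.
  apply: re_exponent_le_sup_scaled => //; first exact: ltW.
  by rewrite -ler_pdivrMr// ltW// truncnS_gt.
move=> /(lt_le_trans xip); rewrite pmulr_rgt0//.
by rewrite exprn_gt0// ltr0n.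
Qed.

End exponent.

(** * The potential measure as a time integral *)

Section integrals_without_measurability.
Context d (T : measurableType d) (R : realType) (mu : {measure set T -> \bar R}).
Local Open Scope ereal_scope.

(** Monotonicity of the integral of nonnegative functions is a property of the
    supremum over simple functions, hence holds for non-measurable integrands. *)
Lemma le_nonneg_integral (D : set T) (f g : T -> \bar R) :
  (forall x, D x -> 0 <= f x) -> (forall x, D x -> f x <= g x) ->
  \int[mu]_(x in D) f x <= \int[mu]_(x in D) g x.
Proof.
move=> f0 fg; rewrite (integral_mkcond D f) (integral_mkcond D g).
have f0' x : 0 <= (f \_ D) x by rewrite patchE; case: ifPn => // /set_mem; exact: f0.
have fg' x : (f \_ D) x <= (g \_ D) x.
  by rewrite !patchE; case: ifPn => // /set_mem; exact: fg.
rewrite !ge0_integralTE//; last by move=> x; exact: le_trans (fg' x).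
apply: le_ereal_sup => _ [h hf <-]; exists h => // x.
exact: le_trans (fg' x).
Qed.

(** The time that a path spends in a ball is only known to agree with a
    measurable function outside a null set of paths; its own measurability is not
    clear. Changing [g] to infinity, then to zero, on [N] squeezes the integral. *)
Lemma eq_nonneg_integral_negligible (N : set T) (f g : T -> \bar R) :
  measurable N -> mu N = 0 -> (forall x, 0 <= f x) -> (forall x, 0 <= g x) ->
  measurable_fun setT g -> (forall x, ~ N x -> f x = g x) ->
  \int[mu]_x f x = \int[mu]_x g x.
Proof.
move=> mN N0 f0 g0 mg fg; apply/eqP; rewrite eq_le; apply/andP; split.
  pose g' x := if x \in N then +oo else g x.
  have mg' : measurable_fun setT g'.
    apply: measurable_fun_ifT => //.
    apply: (measurable_fun_bool true); rewrite setTI.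
    rewrite (_ : _ @^-1` _ = N)//; apply/seteqP; split => x /=.
      by move=> /set_mem.
    by move=> Nx; rewrite mem_set.
  have g'0 x : 0 <= g' x by rewrite /g'; case: ifP => // _; rewrite leey.
  have -> : \int[mu]_x g x = \int[mu]_x g' x.
    apply: ge0_ae_eq_integral => //; exists N; split => // x /= h.
    apply: contrapT => Nx; apply: h => _; rewrite /g'.
    by case: ifPn => // /set_mem.
  apply: le_nonneg_integral => // x _; rewrite /g'; case: ifPn => [_|/negP xN].
    by rewrite leey.
  by rewrite fg// => Nx; apply: xN; rewrite mem_set.
rewrite (@ge0_negligible_integral _ _ _ mu setT N)// setTD [leLHS]integral_mkcond.
apply: le_nonneg_integral => x _; rewrite patchE; case: ifPn => // /set_mem/= Nx.
by rewrite fg.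
Qed.

End integrals_without_measurability.

Section right_continuous_paths.
Context {R : realType} {n : nat} {disp : measure_display}.
Context {Omega : measurableType disp} (P : probability Omega R).
Local Notation E := (euclid R n).
Local Notation leb := (@lebesgue_measure R).
Variables (X : R -> {RV P >-> E}).

(** The next point strictly to the right of [t] on the grid of mesh
    [1 / (m + 1)]. Evaluating paths there approximates them from the right by
    processes that are piecewise constant in time. *)
Definition grid (m : nat) (t : R) : R := (Num.truncn (t * m.+1%:R)).+1%:R / m.+1%:R.

Lemma grid_gt m t : t < grid m t.
Proof. by rewrite /grid ltr_pdivlMr// truncnS_gt. Qed.

Lemma grid_le m t : 0 <= t -> grid m t <= t + m.+1%:R^-1.
Proof.
move=> t0; rewrite /grid ler_pdivrMr// mulrDl mulVf// -natr1 lerD2r truncn_le.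
by rewrite mulr_ge0.
Qed.

Lemma grid_cvg t : 0 <= t -> grid m t @[m --> \oo] --> t^'+.
Proof.
move=> t0 A [e /= e0 eA].
have [N _ HN] : \forall m \near \oo, m.+1%:R^-1 < e :> R.
  by have := near_infty_natSinv_lt (PosNum e0).
exists N => // m /= Nm; apply: eA; last exact: grid_gt.
rewrite /ball/= ltr0_norm ?subr_lt0 ?grid_gt// opprB ltrBlDl.
by rewrite (le_lt_trans (grid_le m t0))// ltrD2l HN.
Qed.

Lemma enorm_cvg_right (f : R -> E) (t : R) :
  (forall i, tnth (f s) i @[s --> t^'+] --> tnth (f t) i) ->
  enorm (f s) @[s --> t^'+] --> enorm (f t).
Proof.
move=> fi; apply: (cvg_comp _ (@Num.sqrt R) _ (@sqrt_continuous R _)).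
rewrite /dotp; apply: cvg_big => // [|i _]; first exact: add_continuous.
by apply: cvgM.
Qed.

(** The grid point takes countably many values, each on an interval of times. *)
Lemma measurable_grid_norm m :
  measurable_fun setT (fun z : Omega * measurableTypeR R => enorm (X (grid m z.2) z.1)).
Proof.
pose T_ (j : nat) : set (measurableTypeR R) := [set t | Num.truncn (t * m.+1%:R) = j].
have mT j : measurable (T_ j).
  apply: is_interval_measurable => s t /= sj tj u /andP[su ut].
  apply/eqP; rewrite eqn_leq; apply/andP; split.
    by rewrite -tj le_truncn// ler_wpM2r.
  by rewrite -[leqLHS]sj le_truncn// ler_wpM2r.
move=> _ B mB; rewrite setTI.
rewrite (_ : _ @^-1` B =
  \bigcup_j ((fun w => enorm (X (j.+1%:R / m.+1%:R) w)) @^-1` B `*` T_ j)); last first.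
  apply/seteqP; split=> [[w t] /= Bwt|[w t] /= [j _ [/= + tj]]].
    by exists (Num.truncn (t * m.+1%:R)).
  by rewrite -tj.
apply: bigcup_measurable => j _; apply: measurableX => //.
have mn : measurable_fun setT (fun w => enorm (X (j.+1%:R / m.+1%:R) w)).
  exact: measurable_enorm.
by rewrite -[X in measurable X]setTI; exact: (mn measurableT _ mB).
Qed.

(** Joint measurability of [(w, t) |-> X t w] is what Tonelli's theorem needs.
    For cadlag paths the norm of [X t w] is the limit of its values at the grid
    points, so the upper limit [H] of these is a jointly measurable version of it,
    correct outside a null set of paths. *)
Lemma potential_measure_time_integral (r : R) :
  {ae P, forall w, cadlag (fun t => X t w)} ->
  potential_measure X (eball r) =
  (\int[leb]_(t in `[0%R, +oo[) P (X t @^-1` eball r))%E.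
Proof.
move=> [N [mN N0 cadlagN]].
have path w (t : R) : ~ N w -> 0 <= t ->
    enorm (X (grid m t) w) @[m --> \oo] --> enorm (X t w).
  move=> Nw t0; have cw : cadlag (fun t => X t w) by apply: contrapT => h; exact/Nw/cadlagN.
  have right := @enorm_cvg_right (fun t => X t w) t (fun i => (cw i).1 t t0).
  exact: (cvg_comp _ _ (grid_cvg t0) right).
pose H (z : Omega * measurableTypeR R) : \bar R :=
  limn_esup (fun m => (enorm (X (grid m z.2) z.1))%:E).
have HE w t : ~ N w -> 0 <= t -> H (w, t) = (enorm (X t w))%:E.
  move=> Nw t0; have c : (enorm (X (grid m t) w))%:E @[m --> \oo] --> (enorm (X t w))%:E.
    by apply: cvg_EFin; [exact: nearW|exact: path].
  rewrite /H/= is_cvg_limn_esupE; last by apply/cvg_ex; exists (enorm (X t w))%:E.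
  exact/cvg_lim.
have mH : measurable_fun setT H.
  apply: measurable_fun_limn_esup => m.
  by apply/measurable_EFinP; exact: (measurable_grid_norm m).
pose S : set (Omega * measurableTypeR R) := [set z | 0 <= z.2 /\ (H z < r%:E)%E].
have mS : measurable S.
  have m1 : measurable_fun setT (fun z : Omega * measurableTypeR R => 0 <= z.2).
    by apply: measurable_fun_ler => //; exact: measurable_snd.
  have m2 := emeasurable_fun_infty_o measurableT mH r%:E.
  have := measurableI _ _ (m1 measurableT [set true] I) m2.
  by congr measurable; apply/seteqP; split => z /=;
    [move=> [[_ h1] [_ h2]]; split|move=> [h1 h2]; split; split].
have SE w t : ~ N w -> 0 <= t -> S (w, t) <-> eball r (X t w).
  by move=> Nw t0; rewrite /S/= HE// lte_fin /eball/=; split => [[]|].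
have mX t : measurable (X t @^-1` eball r).
  have mn : measurable_fun setT (fun w => enorm (X t w)) by exact: measurable_enorm.
  have mlt : measurable_fun setT (fun w => enorm (X t w) < r).
    by apply: measurable_fun_ltr.
  have := mlt measurableT [set true] I.
  by congr measurable; apply/seteqP; split => w /=; [case|split].
transitivity (\int[P]_w leb [set t | S (w, t)])%E.
  apply: (eq_nonneg_integral_negligible mN N0).
  - by move=> w; apply: integral_ge0 => t _; rewrite lee_fin.
  - by move=> w; exact: measure_ge0.
  - have := measurable_fun_xsection leb mS.
    by congr measurable_fun; apply/funext => w; congr (leb _);
      apply/seteqP; split=> t; rewrite /xsection/= inE.
  move=> w Nw.
  have mSw : measurable [set t : measurableTypeR R | S (w, t)].
    have := measurable_xsection w mS.
    by congr measurable; apply/seteqP; split=> t; rewrite /xsection/= inE.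
  transitivity (\int[leb]_t (\1_[set t | S (w, t)] t)%:E)%E; last first.
    by rewrite integral_indic// setIT.
  rewrite [LHS]integral_mkcond.
  apply: eq_integral => t _; rewrite patchE; case: ifPn => [/set_mem|/negP].
    rewrite /= in_itv/= andbT => t0; congr (_%:E); rewrite !indicE.
    by congr (_%:R); congr nat_of_bool; apply/idP/idP; rewrite !inE => /(SE _ _ Nw t0).
  move=> tn; rewrite indicE memNset// => -[t0 _]; apply: tn.
  by rewrite mem_set//= in_itv/= t0.
rewrite (tonelli_set P leb mS) [RHS]integral_mkcond.
apply: eq_integral => t _; rewrite patchE; case: ifPn => [/set_mem|/negP].
  rewrite /= in_itv/= andbT => t0.
  have mSt : measurable [set w | S (w, t)].
    have := measurable_ysection t mS.
    by congr measurable; apply/seteqP; split=> w; rewrite /ysection/= inE.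
  have le_mod A B : measurable A -> measurable B -> (forall w, ~ N w -> A w -> B w) ->
      (P A <= P B)%E.
    move=> mA mB AB.
    apply: (@le_trans _ _ (P (B `|` N))).
      apply: le_measure; rewrite ?inE//; first exact: measurableU.
      by move=> w Aw; have [Nw|Nw] := pselect (N w); [right|left; exact: AB].
    by rewrite measureU0.
  apply/eqP; rewrite eq_le; apply/andP; split; apply: le_mod => //= w Nw.
    by move=> /(SE _ _ Nw t0).
  by move=> /(SE _ _ Nw t0).
move=> tn; rewrite (_ : [set w | _] = set0) ?measure0//.
apply/seteqP; split => w //= [t0 _]; apply: tn.
by rewrite mem_set//= in_itv/= t0.
Qed.

End right_continuous_paths.

(** * A compactly supported averaging of frequencies *)

Section frequency_kernel.
Context {R : realType}.
Local Notation leb := (@lebesgue_measure R).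
Local Notation U := (uniform_prob (@ltr01 R)).
Implicit Types x y z : R.

(** The triangular density [2 * (1 - s)] on [`[0, 1]] is used in the variable
    [z] with [s = z ^+ 3], where it becomes [tri]. Later it has to be integrated
    against [s `^ (- 2 / 3)]; this gives [tri_singular], still a polynomial on
    [`[0, 1]]. *)
Definition tri_singular z : R := 6 * (1 - z ^+ 3) * \1_`[0%R, 1%R] z.
Definition tri z : R := z ^+ 2 * tri_singular z.

(** [(sin (y / 2) / (y / 2)) ^+ 2], the Fourier transform of the triangular
    density on [`[- 1, 1]]. *)
Definition fejer y : R := if y == 0 then 1 else 2 * (1 - cos y) / y ^+ 2.

Lemma tri_singular_ge0 z : 0 <= tri_singular z.
Proof.
rewrite /tri_singular indicE; case: (boolP (z \in _)) => [/set_mem/=|_]; last by rewrite mulr0.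
rewrite in_itv/= => /andP[z0 z1]; rewrite mulr1 mulr_ge0// subr_ge0.
exact: exprn_ile1.
Qed.

Lemma tri_ge0 z : 0 <= tri z.
Proof. by rewrite mulr_ge0 ?sqr_ge0// tri_singular_ge0. Qed.

Lemma tri_le6 z : tri z <= 6.
Proof.
rewrite /tri /tri_singular indicE; case: (boolP (z \in _)) => [/set_mem/=|_]; last by rewrite !mulr0.
rewrite in_itv/= => /andP[z0 z1]; rewrite mulr1 mulrCA ler_piMr//.
have z2 : z ^+ 2 <= 1 by exact: exprn_ile1.
have z3 : z ^+ 3 <= 1 by exact: exprn_ile1.
have z30 : 0 <= z ^+ 3 by exact: exprn_ge0.
by rewrite mulr_ile1 ?sqr_ge0//; lra.
Qed.

Lemma measurable_tri_singular : measurable_fun setT tri_singular.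
Proof.
apply: measurable_funM; last exact: measurable_indic.
apply: measurable_funM; first exact: measurable_cst.
by apply: measurable_funB; [exact: measurable_cst|exact: measurable_funX].
Qed.

Lemma measurable_tri : measurable_fun setT tri.
Proof. by apply: measurable_funM; [exact: measurable_funX|exact: measurable_tri_singular]. Qed.

Lemma integral_uniform01 (f : R -> R) : measurable_fun setT f -> (forall x, 0 <= f x) ->
  (\int[U]_x (f x)%:E = \int[leb]_(x in `[0%R, 1%R]) (f x)%:E)%E.
Proof.
move=> mf f0.
have mf' : measurable_fun setT (fun x => (f x)%:E) by exact/measurable_EFinP.
have f0' x : (0 <= (f x)%:E)%E by rewrite lee_fin.
by rewrite (integral_uniform ltr01 mf' f0') subr0 invr1 mul1e.
Qed.

Lemma integral01_FTC (f F : R -> R) : (forall x, is_derive x 1 F (f x)) ->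
  continuous f -> (\int[leb]_(x in `[0%R, 1%R]) (f x)%:E = (F 1 - F 0)%:E)%E.
Proof.
move=> dF cf.
have cF : continuous F.
  by move=> x; apply/differentiable_continuous/derivable1_diffP; have [] := dF x.
rewrite (@continuous_FTC2 R f F)//.
- exact: continuous_subspaceT.
- split => [x _| |]; first by have [] := dF x.
    by apply: cvg_at_right_filter; exact: cF.
  by apply: cvg_at_left_filter; exact: cF.
- by move=> x _; rewrite derive1E; have [_ ->] := dF x.
Qed.

Lemma continuous_monomial (a : R) n : continuous (fun x : R => a * x ^+ n).
Proof.
by move=> x; apply: cvgM; [exact: cvg_cst|exact: exprn_continuous].
Qed.

Lemma is_derive_id6 x : is_derive x 1 (fun x : R => 2 * x ^+ 3 + - 1 * x ^+ 6)
  (6 * (x ^+ 2 * (1 - x ^+ 3))).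
Proof.
have -> : 6 * (x ^+ 2 * (1 - x ^+ 3)) =
    2 * (3%:R * x ^+ 2) + - 1 * (6%:R * x ^+ 5) by ring.
by apply: is_deriveD; exact: is_derive_monomial.
Qed.

Lemma integral_tri : (\int[U]_z (tri z)%:E = 1%:E)%E.
Proof.
rewrite (integral_uniform01 measurable_tri tri_ge0).
transitivity (\int[leb]_(x in `[0%R, 1%R]) (6 * (x ^+ 2 * (1 - x ^+ 3)))%:E)%E.
  by apply: eq_integral => x /[!inE] x01; rewrite /tri /tri_singular indicE mem_set// mulr1 mulrCA.
rewrite (integral01_FTC is_derive_id6).
  by rewrite !expr0n/= !expr1n; congr (_%:E); ring.
move=> x; apply: cvgM; first exact: cvg_cst.
apply: cvgM; first exact: exprn_continuous.
by apply: cvgB; [exact: cvg_cst|exact: exprn_continuous].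
Qed.

Lemma integral_tri_singular : (\int[U]_z (tri_singular z)%:E = (9 / 2)%:E)%E.
Proof.
rewrite (integral_uniform01 measurable_tri_singular tri_singular_ge0).
transitivity (\int[leb]_(x in `[0%R, 1%R]) (6 * 1 + - 6 * x ^+ 3)%:E)%E.
  apply: eq_integral => x /[!inE] x01.
  by rewrite /tri_singular indicE mem_set// mulrBr mulNr !mulr1.
pose F x : R := 6 * x ^+ 1 + - (3 / 2) * x ^+ 4.
have dF x : is_derive x 1 F (6 * 1 + - 6 * x ^+ 3).
  have -> : 6 * 1 + - 6 * x ^+ 3 =
    6 * (1%:R * x ^+ 0) + - (3 / 2) * (4%:R * x ^+ 3) by rewrite expr0; field.
  by apply: is_deriveD; exact: is_derive_monomial.
rewrite (integral01_FTC dF).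
  by rewrite /F !expr0n/= !expr1n; congr (_%:E); field.
by move=> x; apply: cvgD; [exact: cvg_cst|exact: continuous_monomial].
Qed.

Lemma is_derive_cube (a x : R) (f df : R -> R) : (forall y, is_derive y 1 f (df y)) ->
  is_derive x 1 (fun z => f (a * z ^+ 3)) (df (a * x ^+ 3) * (a * (3%:R * x ^+ 2))).
Proof.
by move=> fdf; apply: (@is_derive1_comp _ f (fun z => a * z ^+ 3)); exact: is_derive_monomial.
Qed.

(** The antiderivative comes from integrating by parts in the variable
    [z ^+ 3]. *)
Lemma integral_tri_1Bcos y :
  (\int[U]_z (tri z * (1 - cos (y * z ^+ 3)))%:E = (1 - fejer y)%:E)%E.
Proof.
rewrite /fejer; have [->|y0] := eqVneq y 0.
  under eq_integral do rewrite mul0r cos0 subrr mulr0.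
  by rewrite integral0 subrr.
have mcos : measurable_fun setT (fun z : R => 1 - cos (y * z ^+ 3)).
  apply: (measurableT_comp (measurable_1Bcos y)); exact: measurable_funX.
have ms : measurable_fun setT (fun z => tri z * (1 - cos (y * z ^+ 3))).
  by apply: measurable_funM; [exact: measurable_tri|exact: mcos].
have s0 z : 0 <= tri z * (1 - cos (y * z ^+ 3)).
  by rewrite mulr_ge0 ?tri_ge0// subr_ge0 cos_le1.
rewrite (integral_uniform01 ms s0).
transitivity (\int[leb]_(x in `[0%R, 1%R])
    (6 * (x ^+ 2 * (1 - x ^+ 3)) * (1 - cos (y * x ^+ 3)))%:E)%E.
  by apply: eq_integral => x /[!inE] x01; rewrite /tri /tri_singular indicE mem_set// mulr1 mulrCA.
pose G z := (2 * z ^+ 3 + - 1 * z ^+ 6) -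
  ((1 + - 1 * z ^+ 3) * (2 / y * sin (y * z ^+ 3)) + - (2 / y ^+ 2) * cos (y * z ^+ 3)).
have dG x : is_derive x 1 G (6 * (x ^+ 2 * (1 - x ^+ 3)) * (1 - cos (y * x ^+ 3))).
  have ds : is_derive x 1 (fun z => 2 / y * sin (y * z ^+ 3))
      (2 / y * (cos (y * x ^+ 3) * (y * (3%:R * x ^+ 2)))).
    by apply: is_deriveZ; apply: is_derive_cube; exact: is_derive_sin.
  have dc : is_derive x 1 (fun z => - (2 / y ^+ 2) * cos (y * z ^+ 3))
      (- (2 / y ^+ 2) * (- sin (y * x ^+ 3) * (y * (3%:R * x ^+ 2)))).
    by apply: is_deriveZ; apply: (@is_derive_cube _ _ _ (fun y => - sin y)); exact: is_derive_cos.
  have d1 : is_derive x 1 (fun z : R => 1 + - 1 * z ^+ 3) (0 + - 1 * (3%:R * x ^+ 2)).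
    by apply: is_deriveD; exact: is_derive_monomial.
  have dp := is_deriveM d1 ds.
  have dG := is_deriveB (is_derive_id6 x) (is_deriveD dp dc).
  by apply: (is_derive_eq dG); rewrite /GRing.scale/=; field.
rewrite (integral01_FTC dG).
  rewrite /G !expr0n/= !expr1n !mulr0 sin0 cos0 !mulr1; congr (_%:E).
  by field.
move=> x; apply: cvgM.
  apply: cvgM; first exact: cvg_cst.
  apply: cvgM; first exact: exprn_continuous.
  by apply: cvgB; [exact: cvg_cst|exact: exprn_continuous].
apply: cvgB; first exact: cvg_cst.
apply: (continuous_comp (f := fun x => y * x ^+ 3) (g := @cos R)).
  exact: continuous_monomial.
exact: continuous_cos.
Qed.

Lemma fejer_ge0 y : 0 <= fejer y.
Proof.
rewrite /fejer; case: ifPn => // _.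
by rewrite divr_ge0 ?sqr_ge0// mulr_ge0// subr_ge0 cos_le1.
Qed.

Lemma fejer_ge_quadratic y : 1 - y ^+ 2 / 12 <= fejer y.
Proof.
rewrite /fejer; case: eqVneq => [->|y0]; first by rewrite expr0n/= mul0r subr0.
have y2 : 0 < y ^+ 2 by rewrite exprn_even_gt0.
rewrite ler_pdivlMr//.
have : cos y <= 1 - y ^+ 2 / 2 + y ^+ 2 * y ^+ 2 / 24.
  wlog y_ge0 : y {y0 y2} / 0 <= y.
    move=> h; have [|yn] := leP 0 y; first exact: h.
    by have := h (- y); rewrite cosN sqrrN; apply; rewrite oppr_ge0 ltW.
  by have := cos_le_quartic y_ge0; rewrite -exprD.
lra.
Qed.

Lemma fejer_le y : 5 / 2 <= `|y| -> fejer y <= 16 / 25.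
Proof.
move=> y1; have y0 : y != 0 by rewrite -normr_gt0; lra.
rewrite /fejer (negPf y0) ler_pdivrMr; last by rewrite exprn_even_gt0.
have : (5 / 2) ^+ 2 <= y ^+ 2.
  rewrite -[leRHS]real_normK ?num_real//; rewrite lerXn2r ?nnegrE//; lra.
by have := cos_geN1 y; lra.
Qed.

End frequency_kernel.

Section triple_average.
Context {R : realType}.
Local Notation leb := (@lebesgue_measure R).
Local Notation U := (uniform_prob (@ltr01 R)).
Local Notation T3 := ((measurableTypeR R * measurableTypeR R) * measurableTypeR R)%type.

Lemma Fubini_bounded d1 d2 (T1 : measurableType d1) (T2 : measurableType d2)
    (P1 : probability T1 R) (P2 : probability T2 R) (F : T1 * T2 -> R) (M : R) :
  measurable_fun setT F -> (forall z, `|F z| <= M) ->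
  (\int[P1]_x \int[P2]_y (F (x, y))%:E = \int[P2]_y \int[P1]_x (F (x, y))%:E)%E.
Proof.
move=> mF FM; apply: (Fubini (m1 := P1) (m2 := P2) (f := fun z => (F z)%:E)).
exact: (bounded_measurable_integrable (P1 \x P2)%E mF FM).
Qed.

Lemma integral_product_bounded d1 d2 (T1 : measurableType d1) (T2 : measurableType d2)
    (P1 : probability T1 R) (P2 : probability T2 R) (f : T1 -> R) (g : T2 -> R)
    (M N a b : R) :
  measurable_fun setT f -> measurable_fun setT g ->
  (forall x, `|f x| <= M) -> (forall y, `|g y| <= N) ->
  (\int[P1]_x (f x)%:E = a%:E)%E -> (\int[P2]_y (g y)%:E = b%:E)%E ->
  (\int[P1 \x P2]_z (f z.1 * g z.2)%:E = (a * b)%:E)%E.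
Proof.
move=> mf mg fM gN fa gb.
have mfg : measurable_fun setT (fun z : T1 * T2 => f z.1 * g z.2).
  by apply: measurable_funM; [exact: (measurableT_comp mf)|exact: (measurableT_comp mg)].
have iP : (P1 \x P2)%E.-integrable setT (EFin \o (fun z : T1 * T2 => f z.1 * g z.2)).
  apply: (@bounded_measurable_integrable _ _ _ (P1 \x P2)%E _ (M * N)) => // z.
  by rewrite normrM ler_pM.
have ifi := bounded_measurable_integrable P1 mf fM.
have igi := bounded_measurable_integrable P2 mg gN.
rewrite -(integral12_prod_meas1 iP).
transitivity (\int[P1]_x ((f x)%:E * b%:E))%E.
  apply: eq_integral => x _; rewrite /fubini_F/=.
  under eq_integral do rewrite EFinM.
  by rewrite (integralZl measurableT igi) gb.
by rewrite (integralZr measurableT ifi) fa.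
Qed.

Lemma integral_tri_cos y : (\int[U]_z (tri z * cos (y * z ^+ 3))%:E = (fejer y)%:E)%E.
Proof.
have mc : measurable_fun setT (fun z : R => cos (y * z ^+ 3)).
  apply: measurable_cos.
  by apply: measurable_funM; [exact: measurable_cst|exact: measurable_funX].
have i1 : U.-integrable setT (EFin \o @tri R).
  apply: (@bounded_measurable_integrable _ _ _ U _ 6); first exact: measurable_tri.
  by move=> z; rewrite ger0_norm ?tri_ge0 ?tri_le6.
have i2 : U.-integrable setT (EFin \o (fun z => tri z * cos (y * z ^+ 3))).
  apply: (@bounded_measurable_integrable _ _ _ U _ 6).
    by apply: measurable_funM; first exact: measurable_tri.
  move=> z; rewrite normrM (ger0_norm (tri_ge0 _)) -[leRHS]mulr1.
  by rewrite ler_pM ?tri_ge0 ?tri_le6 ?cos_max.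
have := integral_tri_1Bcos y.
rewrite (_ : (fun z => _) = (fun z => (tri z)%:E - (tri z * cos (y * z ^+ 3))%:E)%E); last first.
  by apply/funext => z; rewrite mulrBr mulr1 EFinB.
rewrite (integralB_EFin measurableT i1 i2) integral_tri.
have := integrable_fin_num measurableT i2.
move=> /fineK; set I := integral _ _ _ => <-.
by rewrite -EFinB => -[] h; congr (_%:E); lra.
Qed.

(** The uniform law on the unit cube, the reference measure for averages over
    three frequencies. *)
Definition freq_law : probability T3 R := [the probability _ _ of ((U \x U) \x U)%E].

Definition tri3 (z : T3) : R := tri z.1.1 * tri z.1.2 * tri z.2.
Definition tri3_singular (z : T3) : R :=
  tri_singular z.1.1 * tri_singular z.1.2 * tri_singular z.2.
Definition cos3 (y1 y2 y3 : R) (z : T3) : R :=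
  cos (y1 * z.1.1 ^+ 3) * cos (y2 * z.1.2 ^+ 3) * cos (y3 * z.2 ^+ 3).
Definition prod3 (z : T3) : R := z.1.1 * z.1.2 * z.2.

Lemma tri3_ge0 z : 0 <= tri3 z.
Proof. by apply: mulr_ge0; [apply: mulr_ge0|]; exact: tri_ge0. Qed.

Lemma tri3_singular_ge0 z : 0 <= tri3_singular z.
Proof. by apply: mulr_ge0; [apply: mulr_ge0|]; exact: tri_singular_ge0. Qed.

Lemma tri3E z : tri3 z = prod3 z ^+ 2 * tri3_singular z.
Proof. by rewrite /tri3 /tri3_singular /prod3 /tri; ring. Qed.

Lemma measurable_coord3 (f : R -> R) : measurable_fun setT f ->
  [/\ measurable_fun setT (fun z : T3 => f z.1.1),
      measurable_fun setT (fun z : T3 => f z.1.2) &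
      measurable_fun setT (fun z : T3 => f z.2)].
Proof.
move=> mf; split.
- exact: (measurableT_comp mf (measurableT_comp measurable_fst measurable_fst)).
- exact: (measurableT_comp mf (measurableT_comp measurable_snd measurable_fst)).
- exact: (measurableT_comp mf measurable_snd).
Qed.

Lemma measurable_tri3 : measurable_fun setT tri3.
Proof.
have [m1 m2 m3] := measurable_coord3 (@measurable_tri R).
by apply: measurable_funM => //; exact: measurable_funM.
Qed.

Lemma measurable_tri3_singular : measurable_fun setT tri3_singular.
Proof.
have [m1 m2 m3] := measurable_coord3 (@measurable_tri_singular R).
by apply: measurable_funM => //; exact: measurable_funM.
Qed.

Lemma measurable_prod3 : measurable_fun setT prod3.
Proof.
have [m1 m2 m3] := measurable_coord3 (@measurable_id _ (measurableTypeR R) setT).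
by apply: measurable_funM => //; exact: measurable_funM.
Qed.

Lemma tri_singular_le6 (z : R) : tri_singular z <= 6.
Proof.
rewrite /tri_singular indicE; case: (boolP (z \in _)) => [/set_mem/=|_]; last by rewrite mulr0.
rewrite in_itv/= => /andP[z0 z1]; rewrite mulr1.
have : 0 <= z ^+ 3 by exact: exprn_ge0.
lra.
Qed.

Lemma tri3_le z : tri3 z <= 6 * 6 * 6.
Proof.
by apply: ler_pM; [apply: mulr_ge0| |apply: ler_pM|];
  do ?[exact: tri_ge0|exact: tri_le6].
Qed.

Lemma integral_product3 (f g h : R -> R) (a b c : R) :
  measurable_fun setT f -> measurable_fun setT g -> measurable_fun setT h ->
  (forall x, `|f x| <= 6) -> (forall x, `|g x| <= 6) -> (forall x, `|h x| <= 6) ->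
  (\int[U]_x (f x)%:E = a%:E)%E -> (\int[U]_x (g x)%:E = b%:E)%E ->
  (\int[U]_x (h x)%:E = c%:E)%E ->
  (\int[freq_law]_z (f z.1.1 * g z.1.2 * h z.2)%:E = (a * b * c)%:E)%E.
Proof.
move=> mf mg mh f6 g6 h6 fa gb hc.
have mfg : measurable_fun setT (fun z : measurableTypeR R * measurableTypeR R => f z.1 * g z.2).
  by apply: measurable_funM; [exact: (measurableT_comp mf)|exact: (measurableT_comp mg)].
have fg36 z : `|f z.1 * g z.2| <= 6 * 6 by rewrite normrM ler_pM.
have fgab := @integral_product_bounded _ _ _ _ U U f g 6 6 a b mf mg f6 g6 fa gb.
exact: (@integral_product_bounded _ _ _ _ (U \x U)%E U _ h (6 * 6) 6 (a * b) c
  mfg mh fg36 h6 fgab hc).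
Qed.

Lemma integral_tri3 : (\int[freq_law]_z (tri3 z)%:E = 1)%E.
Proof.
have m := @measurable_tri R.
have b x : `|@tri R x| <= 6 by rewrite ger0_norm ?tri_ge0 ?tri_le6.
by rewrite (integral_product3 m m m b b b integral_tri integral_tri integral_tri) !mulr1.
Qed.

Lemma integral_tri3_singular : (\int[freq_law]_z (tri3_singular z)%:E = (729 / 8)%:E)%E.
Proof.
have m := @measurable_tri_singular R.
have b x : `|@tri_singular R x| <= 6 by rewrite ger0_norm ?tri_singular_ge0 ?tri_singular_le6.
have i := @integral_tri_singular R.
by rewrite (integral_product3 m m m b b b i i i); congr (_%:E); field.
Qed.

Lemma integral_tri3_cos3 y1 y2 y3 :
  (\int[freq_law]_z (tri3 z * cos3 y1 y2 y3 z)%:E = (fejer y1 * fejer y2 * fejer y3)%:E)%E.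
Proof.
have m y : measurable_fun setT (fun z : R => tri z * cos (y * z ^+ 3)).
  apply: measurable_funM; first exact: measurable_tri.
  apply: measurable_cos.
  by apply: measurable_funM; [exact: measurable_cst|exact: measurable_funX].
have b (y x : R) : `|tri x * cos (y * x ^+ 3)| <= 6.
  rewrite normrM (ger0_norm (tri_ge0 _)) -[leRHS]mulr1.
  by rewrite ler_pM ?tri_ge0 ?tri_le6 ?cos_max.
rewrite -(integral_product3 (m y1) (m y2) (m y3) (b y1) (b y2) (b y3)
  (integral_tri_cos y1) (integral_tri_cos y2) (integral_tri_cos y3)).
by apply: eq_integral => z _; congr (_%:E); rewrite /tri3 /cos3; ring.
Qed.

(** The exponential law of rate [a] has total mass one. *)
Lemma integral_expRN (a : R) : 0 < a ->
  (\int[leb]_(t in `[0%R, +oo[) (expR (- (t * a)))%:E = (a^-1)%:E)%E.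
Proof.
move=> a0.
have := integral_exponential_pdf a0.
rewrite /exponential_pdf.
have -> : (\int[leb]_x (((fun x => a * expR (- a * x)) \_ `[0, +oo[) x)%:E =
    a%:E * \int[leb]_(t in `[0%R, +oo[) (expR (- (t * a)))%:E)%E.
  rewrite -ge0_integralZl_EFin//; last 2 first.
  - apply/measurable_EFinP; apply: measurable_funTS; apply: (measurableT_comp (@measurable_expR R)).
    by apply: measurable_funN; apply: measurable_funM => //; exact: measurable_cst.
  - exact: ltW.
  rewrite [RHS]integral_mkcond; apply: eq_integral => t _; rewrite !patchE.
  by case: ifPn => // _; rewrite -EFinM mulNr [a * t]mulrC.
move=> /(congr1 (fun e => (a^-1)%:E * e)%E).
by rewrite muleA -EFinM mulVf ?gt_eqF// mul1e mule1.
Qed.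

End triple_average.

(** * Upper bound for the potential of balls *)

Section three_frequencies.
Context {R : realType} {m : nat}.
Local Notation E := (euclid R m.+3).

Definition coord1 : 'I_m.+3 := lift ord0 ord0.
Definition coord2 : 'I_m.+3 := lift ord0 (lift ord0 ord0).

Definition vec3 (a b c : R) : E :=
  [tuple (if val i is i'.+1 then if i' is i''.+1 then if i'' is _.+1 then 0 else c
          else b else a) | i < m.+3].

Lemma dotp_vec3 a b c (x : E) :
  dotp (vec3 a b c) x = a * tnth x ord0 + b * tnth x coord1 + c * tnth x coord2.
Proof.
rewrite /dotp !big_ord_recl big1 => [|i _]; last by rewrite tnth_mktuple/= mul0r.
by rewrite !tnth_mktuple/= addr0 !addrA.
Qed.

Lemma dotp_vec3_sqr a b c : dotp (vec3 a b c) (vec3 a b c) = a ^+ 2 + b ^+ 2 + c ^+ 2.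
Proof. by rewrite dotp_vec3 !tnth_mktuple/= !expr2. Qed.

Lemma sqr_sum3_le (x : E) :
  tnth x ord0 ^+ 2 + tnth x coord1 ^+ 2 + tnth x coord2 ^+ 2 <= dotp x x.
Proof.
rewrite /dotp !big_ord_recl -!expr2 !addrA lerDl.
by apply: sumr_ge0 => i _; rewrite -expr2 sqr_ge0.
Qed.

Lemma cos_mul3 (a b c : R) : cos a * cos b * cos c =
  4^-1 * (cos (a + b + c) + cos (a + b - c) + (cos (a - b + c) + cos (a - b - c))).
Proof. by rewrite !(cosD, sinD, cosN, sinN); field. Qed.

End three_frequencies.

Section ball_kernel_bounds.
Context {R : realType}.

Lemma expR1_ge : 9 / 4 <= expR 1 :> R.
Proof.
have h : 3 / 2 <= expR (1 / 2) :> R by have := @expR_ge1Dx R (1 / 2); lra.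
have -> : expR 1 = expR (1 / 2) * expR (1 / 2) :> R by rewrite -expRD; congr expR; lra.
nra.
Qed.

(** By the quadratic bound the product of the kernels is at least
    [1 - (25 / 4) / 12 = 23 / 48], and [e >= 9 / 4]. *)
Lemma fejer3_lower (y1 y2 y3 : R) : y1 ^+ 2 + y2 ^+ 2 + y3 ^+ 2 <= 25 / 4 ->
  1 <= expR 1 * (fejer y1 * fejer y2 * fejer y3).
Proof.
have e9 := expR1_ge; move=> H.
have [h1 h2 h3] : [/\ 0 <= y1 ^+ 2, 0 <= y2 ^+ 2 & 0 <= y3 ^+ 2] by split; exact: sqr_ge0.
have f1 := fejer_ge_quadratic y1; have f2 := fejer_ge_quadratic y2.
have f3 := fejer_ge_quadratic y3.
set s1 := y1 ^+ 2 in H h1 f1; set s2 := y2 ^+ 2 in H h2 f2; set s3 := y3 ^+ 2 in H h3 f3.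
have p12 : (1 - s1 / 12) * (1 - s2 / 12) <= fejer y1 * fejer y2.
  by apply: ler_pM => //; lra.
have p12' : 1 - s1 / 12 - s2 / 12 <= (1 - s1 / 12) * (1 - s2 / 12).
  have : 0 <= s1 * s2 by exact: mulr_ge0.
  lra.
have p123 : (1 - s1 / 12 - s2 / 12) * (1 - s3 / 12) <= fejer y1 * fejer y2 * fejer y3.
  by apply: ler_pM => //; lra.
have p123' : 23 / 48 <= (1 - s1 / 12 - s2 / 12) * (1 - s3 / 12).
  have : 0 <= (s1 + s2) * s3 by rewrite mulr_ge0// addr_ge0.
  lra.
have : 9 / 4 * (23 / 48) <= expR 1 * (fejer y1 * fejer y2 * fejer y3).
  by apply: ler_pM => //; lra.
lra.
Qed.

(** With frequencies [5 / 2 * z_i ^+ 3 * u], [p] the product of the [z_i] and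
    [xi] the vector of frequencies, the arithmetic-geometric mean inequality gives
    [|xi| ^+ 2 >= 75 / 4 * p ^+ 2 * u ^+ 2]. Hence [damping p] is a lower bound for
    [(1 + (u / |xi|) ^+ 2)^-1], chosen so that its inverse is a constant plus a
    product of functions of the single [z_i]. *)
Definition damping (p : R) : R := 75 / 4 * p ^+ 2 / (1 + 75 / 4 * p ^+ 2).

Lemma damping_den_gt0 (p : R) : 0 < 1 + 75 / 4 * p ^+ 2.
Proof. by have := sqr_ge0 p; lra. Qed.

Lemma measurable_damping : measurable_fun setT damping.
Proof.
apply: continuous_measurable_fun => p; apply: cvgM.
  exact: continuous_monomial.
apply: cvgV; first by rewrite gt_eqF// damping_den_gt0.
by apply: cvgD; [exact: cvg_cst|exact: continuous_monomial].
Qed.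

Lemma damping_gt0 (p : R) : p != 0 -> 0 < damping p.
Proof.
move=> p0; rewrite divr_gt0 ?damping_den_gt0//.
by rewrite mulr_gt0// exprn_even_gt0.
Qed.

Lemma arithmetic_geometric3 (a b c : R) : 0 <= a -> 0 <= b -> 0 <= c ->
  3 * (a * b * c) <= a ^+ 3 + b ^+ 3 + c ^+ 3.
Proof.
move=> a0 b0 c0; rewrite -subr_ge0.
have -> : a ^+ 3 + b ^+ 3 + c ^+ 3 - 3 * (a * b * c) =
    (a + b + c) * ((a - b) ^+ 2 + (b - c) ^+ 2 + (c - a) ^+ 2) / 2 by field.
by rewrite divr_ge0// mulr_ge0 ?addr_ge0// ?sqr_ge0.
Qed.

End ball_kernel_bounds.

Section upper_bound.
Context {R : realType} {m : nat} {disp : measure_display}.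
Context {Omega : measurableType disp} (P : probability Omega R).
Local Notation E := (euclid R m.+3).
Variables (X : R -> {RV P >-> E}) (psi : E -> R[i]).
Hypothesis Xiso : isotropic_unimodal_process X.
Hypothesis Xchar : char_exponent X psi.
Local Notation repsi xi := (complex.Re (psi xi)).
Local Notation sup_psi := (sup_exponent psi).

(** In [sup_exponent_le] take for [n] the least integer above [u / |xi|], so
    that [n ^+ 2 <= 2 * (1 + (u / |xi|) ^+ 2)]. Only the squares of the frequencies
    are prescribed because expanding a product of cosines changes their signs. *)
Lemma re_exponent_ge_damped u (a b c z1 z2 z3 : R) : 0 < u ->
  0 < z1 -> 0 < z2 -> 0 < z3 ->
  a ^+ 2 = (5 / 2 * z1 ^+ 3 * u) ^+ 2 -> b ^+ 2 = (5 / 2 * z2 ^+ 3 * u) ^+ 2 ->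
  c ^+ 2 = (5 / 2 * z3 ^+ 3 * u) ^+ 2 ->
  sup_psi u / 6 * damping (z1 * z2 * z3) <= repsi (vec3 a b c).
Proof.
move=> u0 z10 z20 z30 a2 b2 c2.
set p := z1 * z2 * z3; have p0 : 0 < p by rewrite !mulr_gt0.
set xi := vec3 a b c.
pose G := 75 / 4 * p ^+ 2.
have G0 : 0 < G by rewrite mulr_gt0// exprn_gt0.
have xi2 : u ^+ 2 * G <= enorm xi ^+ 2.
  rewrite enorm_sqr dotp_vec3_sqr a2 b2 c2.
  have := arithmetic_geometric3 (sqr_ge0 z1) (sqr_ge0 z2) (sqr_ge0 z3).
  have u2 : 0 < u ^+ 2 by rewrite exprn_gt0.
  move=> h.
  have -> : u ^+ 2 * G = 25 * u ^+ 2 * (3 * (z1 ^+ 2 * z2 ^+ 2 * z3 ^+ 2)) / 4.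
    by rewrite /G /p; field.
  have -> : (5 / 2 * z1 ^+ 3 * u) ^+ 2 + (5 / 2 * z2 ^+ 3 * u) ^+ 2 +
    (5 / 2 * z3 ^+ 3 * u) ^+ 2 =
    25 * u ^+ 2 * ((z1 ^+ 2) ^+ 3 + (z2 ^+ 2) ^+ 3 + (z3 ^+ 2) ^+ 3) / 4 by field.
  by rewrite ler_pM2r// ler_pM2l// mulr_gt0.
have e0 : 0 < enorm xi.
  rewrite lt_neqAle enorm_ge0 andbT; apply/eqP => h.
  by move: xi2; rewrite -h expr0n/= leNgt mulr_gt0// exprn_gt0.
pose n := (Num.truncn (u / enorm xi)).+1.
have un : u <= n%:R * enorm xi by rewrite -ler_pdivrMr// ltW// truncnS_gt.
have ue0 : 0 <= u / enorm xi by rewrite divr_ge0 ?ltW.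
have nle : n%:R <= u / enorm xi + 1 by rewrite -natr1 lerD2r truncn_le.
have ue2 : (u / enorm xi) ^+ 2 <= G^-1.
  rewrite expr_div_n ler_pdivrMr ?exprn_gt0// mulrC ler_pdivlMr//.
have n2 : n%:R ^+ 2 <= 2 * (1 + G^-1).
  apply: (@le_trans _ _ ((u / enorm xi + 1) ^+ 2)).
    by rewrite lerXn2r ?nnegrE// addr_ge0.
  move: (u / enorm xi) ue2 {ue0 nle} => s s2.
  have := sqr_ge0 (s - 1); rewrite sqrrB1 sqrrD1; lra.
have := sup_exponent_le Xiso Xchar (ltW u0) (ltn0Sn _) un.
have psi0 := re_exponent_ge0 Xiso Xchar xi.
move=> sup_le.
have h : sup_psi u <= 2 * (1 + G^-1) * (3 * repsi xi).
  by apply: (le_trans sup_le); rewrite ler_wpM2r// mulr_ge0.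
have -> : damping p = (1 + G^-1)^-1.
  rewrite /damping -/G; field.
  by rewrite !gt_eqF// addr_gt0.
have G1 : 0 < 1 + G^-1 by rewrite addr_gt0// invr_gt0.
rewrite ler_pdivrMr//; lra.
Qed.

(** A product of cosines is a mean of cosines of signed sums; each of these has
    the expectation [expR (- (t * repsi xi))] for some vector [xi] of frequencies. *)
Lemma expectation_cos_mul3_le (a b c q t : R) : 0 <= t ->
  (forall b' c', b' ^+ 2 = b ^+ 2 -> c' ^+ 2 = c ^+ 2 -> q <= repsi (vec3 a b' c')) ->
  0 <= \int[P]_w (cos (a * tnth (X t w) ord0) * cos (b * tnth (X t w) coord1) *
    cos (c * tnth (X t w) coord2)) <= expR (- (t * q)).
Proof.
move=> t0 Hq.
pose C b' c' w := cos (dotp (vec3 a b' c') (X t w)).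
have mC b' c' : measurable_fun setT (C b' c').
  apply: measurable_cos.
  by apply: measurable_dotp => //; exact: measurable_cst.
have iC b' c' : P.-integrable setT (EFin \o C b' c').
  by apply: (@bounded_measurable_integrable _ _ _ P _ 1) => // w; exact: cos_max.
have -> : \int[P]_w (cos (a * tnth (X t w) ord0) * cos (b * tnth (X t w) coord1) *
    cos (c * tnth (X t w) coord2)) =
    \int[P]_w (4^-1 * ((C b c w + C b (- c) w) + (C (- b) c w + C (- b) (- c) w))).
  by apply: eq_Rintegral => w _; rewrite cos_mul3 /C !dotp_vec3 !mulNr.
have i1 : P.-integrable setT (EFin \o (fun w => C b c w + C b (- c) w)).
  by have := integrableD measurableT (iC b c) (iC b (- c)).
have i2 : P.-integrable setT (EFin \o (fun w => C (- b) c w + C (- b) (- c) w)).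
  by have := integrableD measurableT (iC (- b) c) (iC (- b) (- c)).
have i3 : P.-integrable setT (EFin \o (fun w => (C b c w + C b (- c) w) +
    (C (- b) c w + C (- b) (- c) w))).
  by have := integrableD measurableT i1 i2.
rewrite RintegralZl// RintegralD// RintegralD// RintegralD//.
rewrite !(cos_expectation Xiso Xchar)//.
have bound b' c' : b' ^+ 2 = b ^+ 2 -> c' ^+ 2 = c ^+ 2 ->
    0 <= expR (- (t * repsi (vec3 a b' c'))) <= expR (- (t * q)).
  by move=> hb hc; rewrite expR_ge0 ler_expR lerN2 ler_wpM2l// Hq.
have /andP[p1 l1] := bound b c erefl erefl.
have /andP[p2 l2] := bound b (- c) erefl (sqrrN c).
have /andP[p3 l3] := bound (- b) c (sqrrN b) erefl.
have /andP[p4 l4] := bound (- b) (- c) (sqrrN b) (sqrrN c).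
apply/andP; split; lra.
Qed.

End upper_bound.

Section potential_bounds.
Context {R : realType} {m : nat} {disp : measure_display}.
Context {Omega : measurableType disp} (P : probability Omega R).
Local Notation E := (euclid R m.+3).
Variables (X : R -> {RV P >-> E}) (psi : E -> R[i]).
Hypothesis Xiso : isotropic_unimodal_process X.
Hypothesis Xchar : char_exponent X psi.
Local Notation sup_psi := (sup_exponent psi).
Local Notation leb := (@lebesgue_measure R).
Local Notation Q := (@freq_law R).
Local Notation T3 := ((measurableTypeR R * measurableTypeR R) * measurableTypeR R)%type.

(** The result of averaging over frequencies the expectation at time [t] of a
    product of cosines, for [s] the supremum of the exponent. *)
Definition damped_weight (s : R) (z : T3) (t : R) : R :=
  expR 1 * (tri3 z * expR (- (t * (s / 6 * damping (prod3 z))))).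

Lemma damped_weight_ge0 s z t : 0 <= damped_weight s z t.
Proof. by rewrite mulr_ge0 ?expR_ge0// mulr_ge0 ?expR_ge0// tri3_ge0. Qed.

Lemma measurable_eball (Y : {RV P >-> E}) (r : R) : measurable (Y @^-1` eball r).
Proof.
have mn : measurable_fun setT (fun w => enorm (Y w)) by exact: measurable_enorm.
have mlt : measurable_fun setT (fun w => enorm (Y w) < r).
  by apply: measurable_fun_ltr.
have := mlt measurableT [set true] I.
by congr measurable; apply/seteqP; split => w /=; [case|split].
Qed.

Lemma tri3_neq0 (z : T3) : tri3 z != 0 -> [/\ 0 < z.1.1, 0 < z.1.2 & 0 < z.2].
Proof.
have tri0 (x : R) : tri x != 0 -> 0 < x.
  rewrite /tri /tri_singular indicE; case: (boolP (x \in _)) => [/set_mem/=|_]; last by rewrite !mulr0 eqxx.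
  rewrite in_itv/= => /andP[x0 _]; case: (eqVneq x 0) => [->|x0' _]; first by rewrite expr0n/= mul0r eqxx.
  by rewrite lt_neqAle eq_sym x0'.
have nz (a b : R) : a * b != 0 -> a != 0 /\ b != 0.
  by rewrite mulf_eq0 negb_or => /andP[].
by rewrite /tri3 => /nz[/nz[/tri0 h1 /tri0 h2] /tri0 h3].
Qed.

Lemma measurable_cos3 (f1 f2 f3 : Omega -> R) :
  measurable_fun setT f1 -> measurable_fun setT f2 -> measurable_fun setT f3 ->
  measurable_fun setT (fun z : Omega * T3 => cos3 (f1 z.1) (f2 z.1) (f3 z.1) z.2).
Proof.
move=> m1 m2 m3.
have mcube : measurable_fun setT (fun x : R => x ^+ 3) by exact: measurable_funX.
have [c1 c2 c3] := measurable_coord3 mcube.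
have mcos (f : Omega -> R) (g : T3 -> R) : measurable_fun setT f -> measurable_fun setT g ->
    measurable_fun setT (fun z : Omega * T3 => cos (f z.1 * g z.2)).
  move=> mf mg; apply: measurable_cos.
  by apply: measurable_funM; [exact: (measurableT_comp mf)|exact: (measurableT_comp mg)].
apply: measurable_funM; last exact: (mcos f3 (fun z => z.2 ^+ 3)).
by apply: measurable_funM;
  [exact: (mcos f1 (fun z => z.1.1 ^+ 3))|exact: (mcos f2 (fun z => z.1.2 ^+ 3))].
Qed.

(** On the ball, [e] times the product of the Fejer kernels of three rescaled
    coordinates is at least one, and it is nonnegative elsewhere. That product is
    an average of products of cosines over frequencies, so that exchanging the two
    expectations leaves characteristic functions, bounded by
    [expectation_cos_mul3_le]. *)
Lemma hitting_probability_le (r t : R) : 0 < r -> 0 <= t ->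
  (P (X t @^-1` eball r) <= \int[Q]_z (damped_weight (sup_psi r^-1) z t)%:E)%E.
Proof.
move=> r0 t0; set s := sup_psi r^-1.
pose y i w := 5 / 2 * (tnth (X t w) i / r).
have mX i : measurable_fun setT (fun w => tnth (X t w) i : R) by exact: measurable_coord.
have my i : measurable_fun setT (y i).
  apply: measurable_funM; first exact: measurable_cst.
  by apply: measurable_funM; [exact: mX|exact: measurable_cst].
pose F (z : Omega * T3) : R :=
  expR 1 * (tri3 z.2 * cos3 (y ord0 z.1) (y coord1 z.1) (y coord2 z.1) z.2).
have mF : measurable_fun setT F.
  apply: measurable_funM; first exact: measurable_cst.
  apply: measurable_funM; last exact: measurable_cos3.
  exact: (measurableT_comp measurable_tri3 measurable_snd).
have cos3_le1 a b c (z : T3) : `|cos3 a b c z| <= 1.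
  rewrite /cos3 !normrM -[leRHS]mulr1 ler_pM ?mulr_ge0 ?cos_max//.
  by rewrite -[leRHS]mulr1 ler_pM ?cos_max.
have bF z : `|F z| <= expR 1 * (6 * 6 * 6 * 1).
  rewrite /F normrM (ger0_norm (expR_ge0 _)) ler_wpM2l ?expR_ge0//.
  rewrite normrM (ger0_norm (tri3_ge0 _)) ler_pM ?tri3_ge0//.
  exact: tri3_le.
have inner w : (\int[Q]_z (F (w, z))%:E =
    (expR 1 * (fejer (y ord0 w) * fejer (y coord1 w) * fejer (y coord2 w)))%:E)%E.
  rewrite /F/=; under eq_integral do rewrite EFinM.
  rewrite integralZl//.
    by rewrite integral_tri3_cos3 -EFinM.
  apply: (@bounded_measurable_integrable _ _ _ Q _ (6 * 6 * 6 * 1)).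
    apply: measurable_funM; first exact: measurable_tri3.
    have := measurable_cos3 (my ord0) (my coord1) (my coord2).
    move=> /measurableT_comp/(_ (pair1_measurable w)); exact.
  move=> z; rewrite normrM (ger0_norm (tri3_ge0 _)) ler_pM ?tri3_ge0//.
  exact: tri3_le.
have mB := measurable_eball (X t) r.
apply: (@le_trans _ _ (\int[P]_w \int[Q]_z (F (w, z))%:E)%E).
  have -> : P (X t @^-1` eball r) = (\int[P]_w (\1_(X t @^-1` eball r) w)%:E)%E.
    by rewrite integral_indic// setIT.
  apply: le_nonneg_integral => w _; first by rewrite lee_fin.
  rewrite inner lee_fin indicE.
  case: (boolP (w \in _)) => [/set_mem|_]; last first.
    by rewrite mulr_ge0 ?expR_ge0// !mulr_ge0// fejer_ge0.
  rewrite /eball/= => Yr; apply: fejer3_lower.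
  have d0 : 0 < r ^+ 2 by rewrite exprn_gt0.
  have -> : y ord0 w ^+ 2 + y coord1 w ^+ 2 + y coord2 w ^+ 2 = 25 / 4 *
     ((tnth (X t w) ord0 ^+ 2 + tnth (X t w) coord1 ^+ 2 + tnth (X t w) coord2 ^+ 2) / r ^+ 2).
    by rewrite /y; field; rewrite gt_eqF.
  rewrite ler_piMr// ler_pdivrMr// mul1r (le_trans (sqr_sum3_le _))//.
  by rewrite -enorm_sqr lerXn2r ?nnegrE ?enorm_ge0 ?ltW.
rewrite (Fubini_bounded P Q mF bF).
pose rho z := \int[P]_w cos3 (y ord0 w) (y coord1 w) (y coord2 w) z.
have mcosz z : measurable_fun setT (fun w => cos3 (y ord0 w) (y coord1 w) (y coord2 w) z).
  have mc := measurable_cos3 (my ord0) (my coord1) (my coord2).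
  exact: (measurableT_comp mc (pair2_measurable z)).
have icosz z : P.-integrable setT (EFin \o (fun w => cos3 (y ord0 w) (y coord1 w) (y coord2 w) z)).
  by apply: (@bounded_measurable_integrable _ _ _ P _ 1).
have outer z : (\int[P]_w (F (w, z))%:E = (expR 1 * (tri3 z * rho z))%:E)%E.
  rewrite /F/=; under eq_integral do rewrite mulrA EFinM.
  rewrite (integralZl measurableT (icosz z)) -[X in (_ * X)%E]fineK.
    by rewrite -EFinM mulrA.
  exact: (integrable_fin_num measurableT (icosz z)).
have rho_bound z : 0 <= tri3 z * rho z <= tri3 z * expR (- (t * (s / 6 * damping (prod3 z)))).
  have [->|z0] := eqVneq (tri3 z) 0; first by rewrite !mul0r lexx.
  have [z1 z2 z3] := tri3_neq0 z0.
  have -> : rho z = \int[P]_w (cos (5 / 2 * z.1.1 ^+ 3 * r^-1 * tnth (X t w) ord0) *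
      cos (5 / 2 * z.1.2 ^+ 3 * r^-1 * tnth (X t w) coord1) *
      cos (5 / 2 * z.2 ^+ 3 * r^-1 * tnth (X t w) coord2)).
    by apply: eq_Rintegral => w _; rewrite /cos3 /y; congr (cos _ * cos _ * cos _); ring.
  have ri : 0 < r^-1 by rewrite invr_gt0.
  have /andP[p1 p2] := expectation_cos_mul3_le Xiso Xchar
    (a := 5 / 2 * z.1.1 ^+ 3 * r^-1) (b := 5 / 2 * z.1.2 ^+ 3 * r^-1)
    (c := 5 / 2 * z.2 ^+ 3 * r^-1) (q := s / 6 * damping (prod3 z)) t0
    (fun b' c' hb hc => re_exponent_ge_damped Xiso Xchar ri z1 z2 z3 erefl hb hc).
  by rewrite mulr_ge0 ?tri3_ge0// ler_wpM2l ?tri3_ge0.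
apply: le_nonneg_integral => z _; rewrite outer lee_fin; have /andP[p1 p2] := rho_bound z.
  by rewrite mulr_ge0 ?expR_ge0.
by rewrite ler_wpM2l ?expR_ge0.
Qed.

(** The factor [p ^+ 2] of the weight compensates the singularity of
    [(damping p)^-1] at zero. *)
Lemma damping_weight_inv (s : R) (z : T3) : 0 < s -> prod3 z != 0 ->
  tri3 z * (s / 6 * damping (prod3 z))^-1 =
  6 / s * (tri3 z + 4 / 75 * tri3_singular z).
Proof.
move=> s0 z0; rewrite tri3E /damping.
move: (prod3 z) z0 (tri3_singular z) => p p0 S.
field; rewrite (gt_eqF s0) p0 andbT/= gt_eqF//.
by have := sqr_ge0 p; lra.
Qed.

(** Integrating the exponential over all times leaves the integral of
    [(damping p)^-1 = 1 + 4 / 75 / p ^+ 2] against the law of the frequencies. It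
    equals [1 + 4 / 75 * (9 / 2) ^+ 3], and six times this is [879 / 25 <= 36]. *)
Lemma potential_upper (r : R) : 0 < r -> 0 < sup_psi r^-1 ->
  (\int[leb]_(t in `[0%R, +oo[) P (X t @^-1` eball r) <= (36 * expR 1 / sup_psi r^-1)%:E)%E.
Proof.
move=> r0; set s := sup_psi r^-1 => s0.
pose K (z : T3 * measurableTypeR R) : \bar R :=
  (damped_weight s z.1 z.2 * \1_`[0%R, +oo[ z.2)%:E.
have K0 z : (0 <= K z)%E by rewrite lee_fin mulr_ge0// damped_weight_ge0.
have mK : measurable_fun setT K.
  apply/measurable_EFinP; apply: measurable_funM; last first.
    have mI : measurable_fun setT (\1_`[0%R, +oo[ : measurableTypeR R -> R).
      exact: measurable_indic.
    exact: (measurableT_comp mI measurable_snd).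
  apply: measurable_funM; first exact: measurable_cst.
  apply: measurable_funM; first exact: (measurableT_comp measurable_tri3 measurable_fst).
  apply: (measurableT_comp (@measurable_expR R)); apply: measurable_funN.
  apply: measurable_funM; first exact: measurable_snd.
  apply: measurable_funM; first exact: measurable_cst.
  exact: (measurableT_comp (measurableT_comp measurable_damping measurable_prod3) measurable_fst).
apply: (@le_trans _ _ (\int[leb]_t \int[Q]_z K (z, t))%E).
  rewrite [leLHS]integral_mkcond; apply: le_nonneg_integral => t _; rewrite patchE.
    by case: ifPn => // _; exact: measure_ge0.
  case: ifPn => [|_]; last by apply: integral_ge0 => z _.
  move=> /set_mem/= t0; apply: (le_trans (hitting_probability_le r0 _)).
    by move: t0; rewrite in_itv/= andbT.
  apply: le_nonneg_integral => z _; first by rewrite lee_fin damped_weight_ge0.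
  by rewrite /K/= indicE mem_set// mulr1.
rewrite -(fubini_tonelli (m1 := Q) (m2 := leb) K)//.
have inner z : (\int[leb]_t K (z, t) <=
    (expR 1 * (6 / s) * (tri3 z + 4 / 75 * tri3_singular z))%:E)%E.
  rewrite /K/= integral_mul_indic /damped_weight.
  under eq_integral do rewrite mulrA EFinM.
  rewrite ge0_integralZl_EFin//; last 2 first.
  - apply/measurable_EFinP; apply: measurable_funTS; apply: (measurableT_comp (@measurable_expR R)).
    by apply: measurable_funN; apply: measurable_funM => //; exact: measurable_cst.
  - by rewrite mulr_ge0 ?expR_ge0 ?tri3_ge0.
  have [p0|p0] := eqVneq (prod3 z) 0.
    rewrite tri3E p0 expr0n/= mul0r mulr0 mul0e lee_fin add0r.
    apply: mulr_ge0; last by apply: mulr_ge0 => //; exact: tri3_singular_ge0.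
    by rewrite mulr_ge0 ?expR_ge0// divr_ge0// ltW.
  rewrite integral_expRN; last by rewrite mulr_gt0 ?damping_gt0// divr_gt0.
  by rewrite -EFinM lee_fin -[leLHS]mulrA (damping_weight_inv s0 p0) -[leRHS]mulrA.
apply: (@le_trans _ _ (\int[Q]_z (expR 1 * (6 / s) * (tri3 z + 4 / 75 * tri3_singular z))%:E)%E).
  apply: le_nonneg_integral => z _; last exact: inner.
  by apply: integral_ge0 => t _.
have c0 : 0 <= expR 1 * (6 / s) by rewrite mulr_ge0 ?expR_ge0// divr_ge0// ltW.
under eq_integral do rewrite EFinM.
have mt := measurable_tri3 (R := R); have mts := measurable_tri3_singular (R := R).
have t0 := tri3_ge0 (R := R); have ts0 := tri3_singular_ge0 (R := R).
rewrite ge0_integralZl_EFin//; last 2 first.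
- by move=> z _; rewrite lee_fin addr_ge0// mulr_ge0.
- by apply/measurable_EFinP; apply: measurable_funD => //; apply: measurable_funM.
under eq_integral do rewrite EFinD.
rewrite ge0_integralD//; last 4 first.
- by move=> z _; rewrite lee_fin.
- exact/measurable_EFinP.
- by move=> z _; rewrite lee_fin mulr_ge0.
- by apply/measurable_EFinP; apply: measurable_funM.
under [X in (_ * (_ + X))%E]eq_integral do rewrite EFinM.
rewrite ge0_integralZl_EFin//; last 2 first.
- by move=> z _; rewrite lee_fin.
- exact/measurable_EFinP.
rewrite integral_tri3 integral_tri3_singular -EFinM lee_fin.
have -> : expR 1 * (6 / s) * (1 + 4 / 75 * (729 / 8)) = (879 / 25) * expR 1 / s.
  by field; rewrite gt_eqF.
by rewrite ler_pM2r ?invr_gt0// ler_pM2r ?expR_gt0//; lra.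
Qed.

End potential_bounds.

(** * Lower bound for the potential of balls *)

Section lower_bound.
Context {R : realType} {m : nat} {disp : measure_display}.
Context {Omega : measurableType disp} (P : probability Omega R).
Local Notation d := m.+3.
Local Notation E := (euclid R d).
Variables (X : R -> {RV P >-> E}) (psi : E -> R[i]).
Hypothesis Xiso : isotropic_unimodal_process X.
Hypothesis Xchar : char_exponent X psi.
Local Notation repsi xi := (complex.Re (psi xi)).
Local Notation sup_psi := (sup_exponent psi).
Local Notation leb := (@lebesgue_measure R).
Local Notation U := (uniform_prob (@ltr01 R)).

Definition large_coordinate (r t : R) (i : 'I_d) : set Omega :=
  [set w | r / d%:R <= `|tnth (X t w) i|].

Lemma measurable_large_coordinate r t i : measurable (large_coordinate r t i).
Proof.
have mX : measurable_fun setT (fun w => `|tnth (X t w) i| : R).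
  apply: (measurableT_comp (f := @Num.norm R R)); first by apply: continuous_measurable_fun; exact: norm_continuous.
  exact: measurable_coord.
have mle : measurable_fun setT (fun w => r / d%:R <= `|tnth (X t w) i|).
  by apply: measurable_fun_ler.
have := mle measurableT [set true] I.
by congr measurable; apply/seteqP; split => w /=; [case|split].
Qed.

(** The truncation inequality. With [y] the coordinate times [5 / 2 * d / r],
    the mean of [1 - cos] over frequencies is [1 - fejer y], at least [9 / 25] when
    the coordinate is large. All frequencies are at most [5 / 2 * d / r], hence at
    most [3 * d / r], where the exponent is at most [9 * d ^+ 2 * sup_psi r^-1]. *)
Lemma large_coordinate_probability (r t : R) (i : 'I_d) : 0 < r -> 0 <= t ->
  (P (large_coordinate r t i) <= (25 * d%:R ^+ 2 * (t * sup_psi r^-1))%:E)%E.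
Proof.
move=> r0 t0; set s := sup_psi r^-1.
have d0 : 0 < d%:R :> R by rewrite ltr0n.
have s0 : 0 <= s.
  apply: (le_trans (re_exponent_ge0 Xiso Xchar evzero)).
  by apply: (re_exponent_le_sup Xiso Xchar); rewrite ?enorm0 invr_ge0 ltW.
pose a (z : R) := 5 / 2 * (d%:R / r) * z ^+ 3.
pose y w := 5 / 2 * (tnth (X t w) i * (d%:R / r)).
pose F (q : Omega * measurableTypeR R) : \bar R :=
  (25 / 9 * (tri q.2 * (1 - cos (y q.1 * q.2 ^+ 3))))%:E.
have F0 q : (0 <= F q)%E.
  by rewrite lee_fin mulr_ge0// mulr_ge0 ?tri_ge0// subr_ge0 cos_le1.
have my : measurable_fun setT y.
  apply: measurable_funM; first exact: measurable_cst.
  by apply: measurable_funM; [exact: measurable_coord|exact: measurable_cst].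
have mcube : measurable_fun setT (fun x : R => x ^+ 3) by exact: measurable_funX.
have mF : measurable_fun setT F.
  apply/measurable_EFinP; apply: measurable_funM; first exact: measurable_cst.
  apply: measurable_funM; first exact: (measurableT_comp (@measurable_tri R) measurable_snd).
  apply: measurable_funB; first exact: measurable_cst.
  apply: measurable_cos.
  by apply: measurable_funM;
    [exact: (measurableT_comp my)|exact: (measurableT_comp mcube measurable_snd)].
have mtri (c : R) : measurable_fun setT (fun z : R => tri z * (1 - cos (c * z ^+ 3))).
  apply: measurable_funM; first exact: measurable_tri.
  apply: measurable_funB; first exact: measurable_cst.
  apply: measurable_cos.
  by apply: measurable_funM; first exact: measurable_cst.
have tri_pos (c z : R) : 0 <= tri z * (1 - cos (c * z ^+ 3)).
  by rewrite mulr_ge0 ?tri_ge0// subr_ge0 cos_le1.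
have inner w : (\int[U]_z F (w, z) = (25 / 9 * (1 - fejer (y w)))%:E)%E.
  rewrite /F/=; under eq_integral do rewrite EFinM.
  have p0 (z : R) : setT z -> (0 <= (tri z * (1 - cos (y w * z ^+ 3)))%:E)%E.
    by move=> _; rewrite lee_fin.
  have mp : measurable_fun setT (fun z : R => (tri z * (1 - cos (y w * z ^+ 3)))%:E).
    exact/measurable_EFinP.
  by rewrite (ge0_integralZl_EFin U measurableT p0 mp)// integral_tri_1Bcos -EFinM.
have ml := measurable_large_coordinate r t i.
apply: (@le_trans _ _ (\int[P]_w \int[U]_z F (w, z))%E).
  have -> : P (large_coordinate r t i) = (\int[P]_w (\1_(large_coordinate r t i) w)%:E)%E.
    by rewrite integral_indic// setIT.
  apply: le_nonneg_integral => w _; first by rewrite lee_fin.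
  rewrite indicE; case: (boolP (w \in _)) => [/set_mem|_]; last by apply: integral_ge0 => z _.
  rewrite /large_coordinate/= ler_pdivrMr// => Xw.
  have y52 : 5 / 2 <= `|y w|.
    rewrite /y normrM ger0_norm// -[leLHS]mulr1 ler_wpM2l// normrM.
    by rewrite (ger0_norm (ltW (divr_gt0 d0 r0))) mulrA ler_pdivlMr// mul1r.
  by rewrite inner lee_fin; have := fejer_le y52; lra.
rewrite (fubini_tonelli (m1 := P) (m2 := U) F)//.
have outer z : (\int[P]_w F (w, z) = (25 / 9 * (tri z * (1 - expR (- (t * repsi (evscale (a z) (evbasis i)))))))%:E)%E.
  rewrite /F/=; under eq_integral do rewrite mulrA EFinM.
  have e w : 1 - cos (y w * z ^+ 3) = 1 - cos (dotp (evscale (a z) (evbasis i)) (X t w)).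
    by rewrite dotpZl dotp_evbasis; congr (1 - cos _); rewrite /y /a; ring.
  under eq_integral do rewrite e.
  have p0 w : setT w -> (0 <= (1 - cos (dotp (evscale (a z) (evbasis i)) (X t w)))%:E)%E.
    by move=> _; rewrite lee_fin subr_ge0 cos_le1.
  have mp : measurable_fun setT (fun w =>
      (1 - cos (dotp (evscale (a z) (evbasis i)) (X t w)))%:E).
    apply/measurable_EFinP; apply: measurable_funB; first exact: measurable_cst.
    apply: measurable_cos.
    exact: measurable_dotX.
  have k0 : 0 <= 25 / 9 * tri z by rewrite mulr_ge0// tri_ge0.
  rewrite (ge0_integralZl_EFin P measurableT p0 mp k0).
  rewrite (oneB_cos_expectation Xiso Xchar)// -EFinM; congr (_%:E).
  exact/esym/mulrA.
apply: (@le_trans _ _ (\int[U]_z ((25 * d%:R ^+ 2 * (t * s)) * tri z)%:E)%E).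
  apply: le_nonneg_integral => z _; first by apply: integral_ge0 => w _.
  rewrite outer lee_fin.
  have [->|z0] := eqVneq (tri z) 0; first by rewrite mul0r !mulr0.
  have z01 : 0 <= z <= 1.
    move: z0; rewrite /tri /tri_singular indicE.
    by case: (boolP (z \in _)) => [/set_mem/=|_]; rewrite ?in_itv//= !mulr0 eqxx.
  have /andP[z_ge0 z_le1] := z01.
  have cube1 : z ^+ 3 <= 1 by exact: exprn_ile1.
  have cube0 : 0 <= z ^+ 3 by exact: exprn_ge0.
  have dr0 : 0 < d%:R / r by rewrite divr_gt0.
  have freq : repsi (evscale (a z) (evbasis i)) <= (3 * d)%:R ^+ 2 * s.
    apply: (re_exponent_le_sup_scaled Xiso Xchar) => //; first by rewrite invr_ge0 ltW.
    rewrite enormZ enorm_evbasis mulr1 ger0_norm; last first.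
      by rewrite /a mulr_ge0// mulr_ge0// ltW.
    have h : d%:R / r * z ^+ 3 <= d%:R / r by rewrite ler_piMr// ltW.
    rewrite /a natrM -[leRHS]mulrA -[leLHS]mulrA.
    apply: (@le_trans _ _ (5 / 2 * (d%:R / r))); first by rewrite ler_wpM2l.
    by rewrite ler_wpM2r ?(ltW dr0)//; lra.
  have exp_le : 1 - expR (- (t * repsi (evscale (a z) (evbasis i)))) <= t * (9 * d%:R ^+ 2 * s).
    apply: (le_trans (expRN_le1 _)).
      by rewrite mulr_ge0// (re_exponent_ge0 Xiso Xchar).
    rewrite ler_wpM2l// (le_trans freq)// natrM exprMn.
    by rewrite le_eqVlt; apply/orP; left; apply/eqP; ring.
  rewrite [leLHS]mulrCA [leRHS]mulrC ler_wpM2l ?tri_ge0//.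
  rewrite (_ : 25 * d%:R ^+ 2 * (t * s) = 25 / 9 * (t * (9 * d%:R ^+ 2 * s))); last by field.
  by rewrite ler_wpM2l.
under eq_integral do rewrite EFinM.
have p0 (z : R) : setT z -> (0 <= (tri z)%:E)%E by move=> _; rewrite lee_fin tri_ge0.
have mp : measurable_fun setT (fun z : R => (tri z)%:E).
  by apply/measurable_EFinP; exact: measurable_tri.
have k0 : 0 <= 25 * d%:R ^+ 2 * (t * s) by do ?[apply: mulr_ge0 => //]; exact: sqr_ge0.
by rewrite (ge0_integralZl_EFin U measurableT p0 mp k0) integral_tri mule1.
Qed.

(** If all [d] coordinates are smaller than [r / d], then the vector has norm
    less than [r]. *)
Lemma stay_probability (r t : R) : 0 < r -> 0 <= t ->
  ((1 - 25 * d%:R ^+ 3 * (t * sup_psi r^-1))%:E <= P (X t @^-1` eball r))%E.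
Proof.
move=> r0 t0; have mB := measurable_eball (X t) r.
have d0 : 0 < d%:R :> R by rewrite ltr0n.
pose A (j : nat) := large_coordinate r t (inord j).
have cover : ~` (X t @^-1` eball r) `<=` \big[setU/set0]_(j < d) A j.
  move=> w /negP; rewrite /eball/= -leNgt => rX; apply: contrapT => notA.
  have small i : tnth (X t w) i ^+ 2 < (r / d%:R) ^+ 2.
    rewrite -[ltLHS]real_normK ?num_real// ltrXn2r// ltNge.
    apply/negP => large; apply: notA; rewrite -bigcup_mkord.
    by exists i => //=; rewrite /A /large_coordinate/= inord_val.
  have : dotp (X t w) (X t w) <= r ^+ 2 / d%:R.
    apply: (@le_trans _ _ (\sum_(i < d) (r / d%:R) ^+ 2)).
      by apply: ler_sum => i _; rewrite -expr2 ltW.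
    rewrite sumr_const card_ord -[leLHS]mulr_natl expr_div_n le_eqVlt; apply/orP; left.
    by apply/eqP; field; rewrite gt_eqF.
  rewrite -enorm_sqr leNgt => /negP; apply.
  apply: (@lt_le_trans _ _ (r ^+ 2)); last by rewrite lerXn2r ?nnegrE ?enorm_ge0 ?(ltW r0).
  rewrite ltr_pdivrMr// ltr_pMr ?exprn_gt0//.
  by rewrite ltr1n.
have mA j : measurable (A j) by exact: measurable_large_coordinate.
have exit_le : (P (~` (X t @^-1` eball r)) <= (25 * d%:R ^+ 3 * (t * sup_psi r^-1))%:E)%E.
  apply: (@le_trans _ _ (\sum_(j < d) P (A j))%E).
    apply: (le_trans _ (Boole_inequality P (fun j _ => mA j))).
    apply: le_measure; rewrite ?inE//; first exact: measurableC.
    exact: bigsetU_measurable.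
  apply: (@le_trans _ _ (\sum_(j < d) (25 * d%:R ^+ 2 * (t * sup_psi r^-1))%:E)%E).
    by apply: lee_sum => j _; exact: large_coordinate_probability.
  rewrite sumEFin lee_fin sumr_const card_ord -[leLHS]mulr_natl le_eqVlt; apply/orP; left.
  by apply/eqP; ring.
have fB : P (X t @^-1` eball r) \is a fin_num by exact: fin_num_measure.
move: exit_le; rewrite probability_setC// -(fineK fB) -EFinB !lee_fin.
lra.
Qed.

(** Up to the time [T] the process is in the ball with probability at least one half. *)
Lemma potential_lower (r : R) : 0 < r -> 0 < sup_psi r^-1 ->
  (((100 * d%:R ^+ 3)^-1 / sup_psi r^-1)%:E <=
   \int[leb]_(t in `[0%R, +oo[) P (X t @^-1` eball r))%E.
Proof.
move=> r0; set s := sup_psi r^-1 => s0.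
have d0 : 0 < d%:R :> R by rewrite ltr0n.
have d3 : 0 < d%:R ^+ 3 :> R by rewrite exprn_gt0.
pose T := (50 * d%:R ^+ 3 * s)^-1.
have T0 : 0 < T by rewrite invr_gt0 mulr_gt0// mulr_gt0.
apply: (@le_trans _ _ (\int[leb]_(t in `[0%R, T]) (2^-1)%:E)%E).
  rewrite integral_cst// [X in (_ * X)%E]lebesgue_measure_itv/= lte_fin T0 -EFinD -EFinM lee_fin.
  rewrite subr0 /T le_eqVlt; apply/orP; left; apply/eqP; field.
  by rewrite !gt_eqF.
rewrite [leLHS]integral_mkcond [leRHS]integral_mkcond.
apply: le_nonneg_integral => t _; rewrite !patchE.
  by case: ifPn.
case: ifPn => [|_]; last by case: ifPn => // _; exact: measure_ge0.
move=> /set_mem/=; rewrite in_itv/= => /andP[t0 tT].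
rewrite mem_set/= ?in_itv/= ?t0//.
apply: (le_trans _ (stay_probability r0 t0)); rewrite lee_fin.
have ts : t * s <= (50 * d%:R ^+ 3)^-1.
  by rewrite -ler_pdivlMr// -invfM; exact: tT.
have : 25 * d%:R ^+ 3 * (t * s) <= 25 * d%:R ^+ 3 * (50 * d%:R ^+ 3)^-1.
  by rewrite ler_wpM2l// mulr_ge0// ltW.
rewrite (_ : 25 * d%:R ^+ 3 * (50 * d%:R ^+ 3)^-1 = 2^-1); last by field; rewrite gt_eqF.
by rewrite -/s; lra.
Qed.

End lower_bound.

(** * The potential of balls *)

Theorem proposition2 (R : realType) (d : nat) (hd : (3 <= d)%N) :
  exists2 C2 : R, 0 < C2 &
    forall (disp : measure_display) (Omega : measurableType disp)
      (P : probability Omega R) (X : R -> {RV P >-> euclid R d})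
      (psi : euclid R d -> R[i]),
      levy_process X ->
      isotropic_unimodal_process X ->
      char_exponent X psi ->
      (exists xi, psi xi <> 0) ->
      forall r : R, 0 < r ->
        ((C2 / sup_exponent psi r^-1)%:E <= potential_measure X (eball r))%E /\
        (potential_measure X (eball r)
           <= (36 * expR 1 / sup_exponent psi r^-1)%:E)%E.
Proof.
case: d hd => [|[|[|m]]]// _.
exists (100 * m.+3%:R ^+ 3)^-1; first by rewrite invr_gt0 mulr_gt0// exprn_gt0// ltr0n.
move=> disp Omega P X psi [_ _ _ _ Xcadlag] Xiso Xchar psi0 r r0.
have s0 : 0 < sup_exponent psi r^-1.
  by apply: (sup_exponent_gt0 Xiso Xchar) => //; rewrite invr_gt0.
rewrite (potential_measure_time_integral r Xcadlag).
by split; [exact: potential_lower|exact: potential_upper].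
Qed.
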